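(* Let $(X,d,\mu)$ be $Q$-homogeneous, $0<\alpha<Q$, and $\Phi,\Psi\in\mathcal{Y}$. Suppose there is a constant $A>0$ such that $$\int_r^\infty t^{\alpha-1}\Phi^{-1}(t^{-Q})\,dt\le A\,r^\alpha\Phi^{-1}(r^{-Q})\qquad\text{for all }0<r<\infty.$$ Then the condition $(\ast)$ there is a constant $A'>0$ such that $r^\alpha\Phi^{-1}(r^{-Q})\le A'\,\Psi^{-1}(r^{-Q})$ for all $0<r<\infty$ is necessary and sufficient for the boundedness of $I_\alpha$ from $L_\Phi(X)$ to $WL_\Psi(X)$. Moreover, if $\Phi\in\nabla_2$, then condition $(\ast)$ is necessary and sufficient for the boundedness of $I_\alpha$ from $L_\Phi(X)$ to $L_\Psi(X)$.
   Context: $(X,d,\mu)$ is a space of homogeneous type: $X$ is a topological space with a quasi-distance $d$ (i.e. $d(x,y)\ge 0$, $d(x,y)=0$ iff $x=y$, $d(x,y)=d(y,x)$, $d(x,y)\le K_1(d(x,z)+d(z,y))$) and a positive measure $\mu$; the balls $B(x,r)=\{y\in X:d(x,y)<r\}$, $r>0$, form a basis of neighborhoods of $x$; $\mu$ is defined on a $\sigma$-algebra containing the balls, and $0<\mu(B(x,2r))\le K_2\mu(B(x,r))<\infty$; $K_1,K_2\ge1$ are constants independent of $x,y,z,r$. Standing assumptions: $\mu(X)=\infty$; the compactly supported continuous functions are dense in $L_1(X,\mu)$. $X$ is $Q$-homogeneous ($Q>0$): $K_3^{-1}r^Q\le\mu(B(x,r))\le K_3r^Q$ for all $x\in X$, $r>0$,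 with a constant $K_3\ge1$. A Young function is a convex, left-continuous $\Phi:[0,\infty)\to[0,\infty]$ with $\lim_{r\to+0}\Phi(r)=\Phi(0)=0$ and $\lim_{r\to\infty}\Phi(r)=\infty$. $\mathcal{Y}$ is the set of Young functions with $0<\Phi(r)<\infty$ for $0<r<\infty$. $\Phi^{-1}(s)=\inf\{r\ge0:\Phi(r)>s\}$ ($\inf\emptyset=\infty$). $\Phi\in\nabla_2$ means $\Phi(r)\le\frac1{2k}\Phi(kr)$ for all $r\ge0$, for some $k>1$. $L_\Phi(X)$ is the set of $f\in L_1^{\rm loc}(X)$ with $\int_X\Phi(\epsilon|f|)d\mu<\infty$ for some $\epsilon>0$, with $\|f\|_{L_\Phi}=\inf\{\lambda>0:\int_X\Phi(|f(x)|/\lambda)d\mu(x)\le1\}$. $WL_\Phi(X)$ is the set of $f\in L_1^{\rm loc}(X)$ with $\sup_{r>0}\Phi(r)\,d_{\epsilon f}(r)<\infty$ for some $\epsilon>0$, with $\|f\|_{WL_\Phi}=\inf\{\lambda>0:\sup_{t>0}\Phi(t/\lambda)d_f(t)\le1\}$, where $d_f(t)=\mu(\{x\in X:|f(x)|>t\})$. $I_\alpha f(x)=\int_X\frac{f(y)}{d(x,y)^{Q-\alpha}}d\mu(y)$, $0<\alpha<Q$. An operator $T$ is bounded from $A$ to $A'$ if there is $C>0$ with $\|Tf\|_{A'}\le C\|f\|_A$ for all $f\in A$. *)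

(* Defs.v *)
From HB Require Import structures.
From mathcomp Require Import all_boot all_order all_algebra.
From mathcomp Require Import all_classical all_reals all_analysis.
From mathcomp Require Import measurable_realfun.
Set Implicit Arguments.
Unset Strict Implicit.
Unset Printing Implicit Defensive.
Import Order.TTheory GRing.Theory Num.Theory.
Import numFieldNormedType.Exports.
Local Open Scope classical_set_scope.
Local Open Scope ring_scope.
Local Open Scope ereal_scope.

(* The topology and the sigma-algebra are not assumed to be related here;
   [homogeneous_type] links both to the balls. *)
#[short(type="topMeasurableType")]
HB.structure Definition TopMeasurable d :=
  {T of Topological T & Measurable d T}.

Section homogeneous_spaces.
Context {R : realType} {disp : measure_display} {X : topMeasurableType disp}.

Definition quasi_distance (d : X -> X -> R) :=
  [/\ forall x y, (0 <= d x y)%R,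
      forall x y, d x y = 0%R <-> x = y,
      forall x y, d x y = d y x &
      exists2 K1 : R, (1 <= K1)%R &
        forall x y z, (d x y <= K1 * (d x z + d z y))%R].

Definition qball (d : X -> X -> R) (x : X) (r : R) : set X :=
  [set y | (d x y < r)%R].

Definition homogeneous_type (d : X -> X -> R)
    (mu : {measure set X -> \bar R}) :=
  [/\ quasi_distance d,
      forall x, nbhs x = filter_from [set r : R | (0 < r)%R] (qball d x),
      forall x r, (0 < r)%R -> measurable (qball d x r) &
      exists2 K2 : R, (1 <= K2)%R & forall x r, (0 < r)%R ->
        [/\ 0 < mu (qball d x (2 * r)),
            mu (qball d x (2 * r)) <= K2%:E * mu (qball d x r) &
            K2%:E * mu (qball d x r) < +oo]].

Definition Cc_dense_L1 (mu : {measure set X -> \bar R}) :=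
  forall f : X -> R, mu.-integrable setT (EFin \o f) ->
  forall e : R, (0 < e)%R -> exists g : X -> R,
    [/\ continuous g, compact (closure [set x | g x != 0%R]),
        mu.-integrable setT (EFin \o g) &
        \int[mu]_x `|f x - g x|%:E < e%:E].

Definition Q_homogeneous (d : X -> X -> R) (mu : {measure set X -> \bar R})
    (Q : R) :=
  exists2 K3 : R, (1 <= K3)%R & forall x r, (0 < r)%R ->
    (K3^-1 * r `^ Q)%:E <= mu (qball d x r) <= (K3 * r `^ Q)%:E.

End homogeneous_spaces.

Section young_functions.
Context {R : realType}.

(* A function on [0, +oo[ is represented by a function on R whose values at
   negative arguments are irrelevant. *)
Definition young (Phi : R -> \bar R) :=
  [/\ forall r : R, (0 <= r)%R -> 0 <= Phi r,
      forall x y t : R, (0 <= x)%R -> (0 <= y)%R -> (0 <= t <= 1)%R ->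
        Phi (t * x + (1 - t) * y)%R <= t%:E * Phi x + (1 - t)%:E * Phi y,
      forall r : R, (0 < r)%R -> Phi s @[s --> r^'-] --> Phi r,
      Phi 0%R = 0 /\ Phi r @[r --> 0%R^'+] --> 0 &
      Phi r @[r --> +oo%R] --> +oo].

Definition young_Y (Phi : R -> \bar R) :=
  young Phi /\ forall r : R, (0 < r)%R -> 0 < Phi r < +oo.

Definition young_inv (Phi : R -> \bar R) (s : R) : \bar R :=
  ereal_inf [set r%:E | r in [set r : R | (0 <= r)%R /\ s%:E < Phi r]].

Definition nabla2 (Phi : R -> \bar R) :=
  exists2 k : R, (1 < k)%R &
    forall r : R, (0 <= r)%R -> Phi r <= (2 * k)^-1%:E * Phi (k * r)%R.

(* Phi(+oo) = +oo: measurable functions below are extended real-valued, and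
   Phi is applied to their absolute values. *)
Definition young_ext (Phi : R -> \bar R) (x : \bar R) : \bar R :=
  if x is r%:E then Phi r else +oo.

End young_functions.

Section orlicz_spaces.
Context {R : realType} {disp : measure_display} {X : topMeasurableType disp}.
Variables (d : X -> X -> R) (mu : {measure set X -> \bar R}).
Implicit Types (f : X -> \bar R) (Phi : R -> \bar R).

Definition L1loc : set (X -> \bar R) :=
  [set f | measurable_fun setT f /\
    forall x r, (0 < r)%R -> mu.-integrable (qball d x r) f].

Definition orlicz Phi : set (X -> \bar R) :=
  [set f | L1loc f /\ exists2 eps : R, (0 < eps)%R &
    \int[mu]_x young_ext Phi (eps%:E * `|f x|) < +oo].

Definition orlicz_norm Phi f : \bar R :=
  ereal_inf [set l%:E | l in [set l : R | (0 < l)%R /\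
    \int[mu]_x young_ext Phi (`|f x| / l%:E) <= 1]].

(* The outer measure [mu^*] extends [mu] and makes the norm below meaningful
   for a function that is not known to be measurable. *)
Definition distribution_fun f (t : R) : \bar R :=
  (mu^*)%mu [set x | t%:E < `|f x|].

Definition weak_orlicz Phi : set (X -> \bar R) :=
  [set f | L1loc f /\ exists2 eps : R, (0 < eps)%R &
    ereal_sup [set Phi r * distribution_fun (fun x => eps%:E * f x) r |
               r in [set r : R | (0 < r)%R]] < +oo].

Definition weak_orlicz_norm Phi f : \bar R :=
  ereal_inf [set l%:E | l in [set l : R | (0 < l)%R /\
    ereal_sup [set Phi (t / l)%R * distribution_fun f t |
               t in [set t : R | (0 < t)%R]] <= 1]].

(* Where the integral does not converge absolutely its value is +oo or -oo, so
   for a measurable [fractional_integral Q alpha f] finiteness of either norm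
   includes its almost everywhere convergence. The kernel is +oo on the
   diagonal, by the convention 0^-1 = +oo in \bar R. *)
Definition fractional_integral (Q alpha : R) f (x : X) : \bar R :=
  \int[mu]_y (f y / (d x y `^ (Q - alpha))%:E).

(* T f is required to belong to A' as soon as it is measurable. Measurability
   is not part of the assertion since it may fail for [fractional_integral]:
   the balls are measurable, but nothing makes [d] jointly measurable. *)
Definition bounded_operator (A A' : set (X -> \bar R))
    (normA normA' : (X -> \bar R) -> \bar R)
    (T : (X -> \bar R) -> X -> \bar R) :=
  exists2 C : R, (0 < C)%R & forall f, A f ->
    (measurable_fun setT (T f) -> A' (T f)) /\
    normA' (T f) <= C%:E * normA f.

End orlicz_spaces.

Definition star_condition {R : realType} (Q alpha : R)
    (Phi Psi : R -> \bar R) :=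
  exists2 A' : R, (0 < A')%R & forall r : R, (0 < r)%R ->
    (r `^ alpha)%:E * young_inv Phi (r `^ (- Q)) <=
    A'%:E * young_inv Psi (r `^ (- Q)).

(* Main.v *)
(* Everything is done without a maximal function. For g = |f| normalised by
   int Phi(g) <= 1 and a level s, choose r with Phi(s) = r^-Q. Dyadic annuli
   around x bound I_alpha g (x) by
   - the part over d(x,y) >= r, at most C r^alpha Phi^-1(r^-Q) = C r^alpha s: on a
     ball of radius rho, g is integrated by cutting at the level
     Phi^-1(rho^-Q), and the dyadic sum is compared with the integral
     hypothesis;
   - the part over d(x,y) < r of min(g, s), at most C r^alpha s;
   - the part over d(x,y) < r of g 1_{g>s}, whose L^1 norm is at most
     C r^alpha int g 1_{g>s}.
   As d need not be jointly measurable, the last part is first majorised by a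
   measurable function built from a countable cover by balls, and only that
   function is integrated. By condition (star), r^alpha s <= A' Psi^-1(Phi(s)), so
   I_alpha g <= C Psi^-1(Phi(s)) outside a measurable set E_s with
   s mu(E_s) <= int g 1_{g>s}. Since Phi(s)/s is nondecreasing, this is the weak
   estimate; for Phi in nabla_2, summing over the levels s = k^j, j in Z, gives
   the strong one. Necessity is seen on multiples of indicators of balls. *)
Require Import Defs.
From mathcomp Require Import all_boot all_order all_algebra.
From mathcomp Require Import all_classical all_reals all_analysis.
From mathcomp Require Import measurable_realfun.
From mathcomp Require Import ring lra.
Set Implicit Arguments.
Unset Strict Implicit.
Unset Printing Implicit Defensive.
Import Order.TTheory GRing.Theory Num.Theory.
Import numFieldNormedType.Exports.
Local Open Scope classical_set_scope.
Local Open Scope ring_scope.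
Local Open Scope ereal_scope.

(** * Integrals, series and powers *)

Section nonmeasurable_integral.
Context d (T : measurableType d) (R : realType) (mu : {measure set T -> \bar R}).
Implicit Types f g : T -> \bar R.

(* The integral of a nonnegative function is a supremum over the simple
   functions below it, hence monotone without any measurability. *)
Lemma ge0_le_lower_integral (D : set T) f g :
  (forall x, D x -> 0 <= f x) -> (forall x, D x -> f x <= g x) ->
  \int[mu]_(x in D) f x <= \int[mu]_(x in D) g x.
Proof.
move=> f0 fg.
have g0 x : D x -> 0 <= g x by move=> Dx; rewrite (le_trans (f0 _ Dx))// fg.
rewrite !ge0_integralE//; apply: ereal_sup_le => _ [h /= hf <-].
exists h => //= x; rewrite (le_trans (hf x))//.
by apply: lee_restrict.
Qed.

(** The constant [c] on [A], extended by zero, lies below [f]. Markov's inequality thus also holds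
    for functions such as [fractional_integral], which are not known to be measurable. *)
Lemma lower_markov (A : set T) f (c : R) : measurable A -> (0 <= c)%R ->
  (forall x, 0 <= f x) -> (forall x, A x -> c%:E <= f x) ->
  c%:E * mu A <= \int[mu]_x f x.
Proof.
move=> mA c0 f0 cf; rewrite -integral_cst// integral_mkcond.
apply: ge0_le_lower_integral => x _.
  by apply: erestrict_ge0 => ? _; rewrite lee_fin.
by rewrite patchE; case: ifPn => // /[!inE]; exact: cf.
Qed.

Lemma ge0_measurable_nneseries (f : nat -> T -> \bar R) :
  (forall k x, 0 <= f k x) -> (forall k, measurable_fun setT (f k)) ->
  measurable_fun setT (fun x => \sum_(k <oo) f k x).
Proof. by move=> f0 mf; apply: ge0_emeasurable_sum. Qed.

End nonmeasurable_integral.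

Section series.
Context {R : realType}.
Implicit Type u : nat -> \bar R.

Lemma nneseries_le_bound u (M : \bar R) : (forall n, 0 <= u n) ->
  (forall n, \sum_(0 <= i < n) u i <= M) -> \sum_(i <oo) u i <= M.
Proof.
move=> u0 uM; apply: lime_le; first exact: is_cvg_nneseries.
exact: nearW.
Qed.

Lemma nneseries_ge_term u n : (forall n, 0 <= u n) -> u n <= \sum_(i <oo) u i.
Proof.
move=> u0; apply: le_trans (nneseries_lim_ge n.+1 _) => //.
by rewrite big_nat_recr//= leeDr// sume_ge0.
Qed.

Lemma nneseries_unbounded u : (forall n, 0 <= u n) ->
  (forall M : R, exists n, M%:E <= u n) -> \sum_(i <oo) u i = +oo.
Proof.
move=> u0 uM; apply/eqyP => M _; have [n Mn] := uM M.
exact: le_trans Mn (nneseries_ge_term _ _).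
Qed.

Lemma nneseries_geometric_le (c q : R) : (0 <= c)%R -> (0 < q < 1)%R ->
  \sum_(k <oo) (c * q ^+ k)%:E <= (c / (1 - q))%:E.
Proof.
move=> c0 /andP[q0 q1]; apply: nneseries_le_bound => n.
  by rewrite lee_fin mulr_ge0// exprn_ge0// ltW.
rewrite sumEFin lee_fin.
by apply: (@geometric_le_lim _ n) => //; rewrite gtr0_norm.
Qed.

(** A sum of terms that at least double is at most twice its last term. Trailing indices outside [P]
    are discarded until the last one satisfies [P]. *)
Lemma sum_doubling_le (p : nat -> R) (P : pred nat) (B : R) (n : nat) :
  (forall i, 0 <= p i)%R -> (forall i, p i <= p i.+1 / 2)%R -> (0 <= B)%R ->
  (forall i, P i -> p i <= B)%R ->
  (\sum_(i < n | P i) p i <= 2 * B)%R.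
Proof.
move=> p0 p2 B0 pB; have sp m : (\sum_(i < m.+1) p i <= 2 * p m)%R.
  elim: m => [|m IH]; first by rewrite big_ord1; have := p0 0%N; lra.
  by rewrite big_ord_recr/=; have := p2 m; lra.
elim: n => [|n IH]; first by rewrite big_ord0 mulr_ge0.
have [Pn|nPn] := boolP (P n); last first.
  rewrite big_mkcond big_ord_recr/= (negbTE nPn) addr0 -big_mkcond/=.
  exact: IH.
apply: (le_trans (y := (\sum_(i < n.+1) p i)%R)).
  by rewrite big_mkcond/=; apply: ler_sum => i _; case: ifP.
by rewrite (le_trans (sp n))// ler_pM2l// pB.
Qed.

(** Mirror image of [sum_doubling_le]: leading indices outside [P] are discarded, and the first
    remaining term dominates the sum. *)
Lemma sum_halving_le (p : nat -> R) (P : pred nat) (B : R) (n : nat) :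
  (forall i, 0 <= p i)%R -> (forall i, p i.+1 <= p i / 2)%R -> (0 <= B)%R ->
  (forall i, P i -> p i <= B)%R ->
  (\sum_(i < n | P i) p i <= 2 * B)%R.
Proof.
move=> p0 p2 B0 pB.
(* The subtracted term makes the induction close. *)
have sp (q : nat -> R) m : (forall i, 0 <= q i)%R ->
    (forall i, q i.+1 <= q i / 2)%R -> (\sum_(i < m) q i <= 2 * q 0%N - 2 * q m)%R.
  move=> q0 q2; elim: m => [|m IH]; first by rewrite big_ord0 subrr.
  by rewrite big_ord_recr/=; move: (q2 m) IH; lra.
elim: n p P p0 p2 pB => [|n IH] p P p0 p2 pB.
  by rewrite big_ord0 mulr_ge0.
have [P0|nP0] := boolP (P 0%N).
  apply: (le_trans (y := (\sum_(i < n.+1) p i)%R)).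
    by rewrite big_mkcond/=; apply: ler_sum => i _; case: ifP.
  by have := sp _ n.+1 p0 p2; have := pB _ P0; have := p0 n.+1; lra.
rewrite big_mkcond big_ord_recl/= (negbTE nP0) add0r -big_mkcond/=.
by apply: (IH (fun i => p i.+1) (fun i => P i.+1)) => // i; exact: pB.
Qed.

End series.

Section powers.
Context {R : realType}.

Lemma exists_lt_expr (b v : R) : (1 < b)%R -> exists n, (v < b ^+ n)%R.
Proof.
move=> b1; exists (Num.truncn (v / (b - 1))).+1.
set n := _.+1.
have b0 : (0 < b - 1)%R by rewrite subr_gt0.
have : (v / (b - 1) < n%:R)%R by rewrite truncnS_gt.
rewrite ltr_pdivrMr// => vn; apply: (lt_le_trans vn).
(* Bernoulli's inequality, in the form n (b - 1) <= b^n. *)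
elim: {vn} n => [|n IH]; first by rewrite mul0r expr0.
rewrite exprS -natr1.
have y1 : (1 <= b ^+ n)%R by rewrite exprn_ege1// ltW.
have : (0 <= (b - 1) * (b ^+ n - 1))%R by rewrite mulr_ge0 ?subr_ge0// ltW.
lra.
Qed.

Lemma exists_expr_bracket (b v : R) : (1 < b)%R -> (1 <= v)%R ->
  exists n, (b ^+ n <= v < b ^+ n.+1)%R.
Proof.
move=> b1 v1; have [m vm] := exists_lt_expr v b1.
elim: m vm => [|m IH] vm; first by move: vm; rewrite expr0 ltNge v1.
by have [/IH//|] := ltP v (b ^+ m)%R; exists m; apply/andP.
Qed.

(** The strict inequality is on the left here: it yields membership in open balls and strict
    superlevel conditions. *)
Lemma exists_expr_bracket_lt (b v : R) : (1 < b)%R -> (1 < v)%R ->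
  exists n, (b ^+ n < v <= b ^+ n.+1)%R.
Proof.
move=> b1 v1; have [m vm] := exists_lt_expr v b1.
elim: m vm => [|m IH] vm.
  by move: vm; rewrite expr0 ltNge (ltW v1).
have [bv|] := ltP (b ^+ m)%R v; first by exists m; rewrite bv ltW.
rewrite le_eqVlt => /predU1P[vE|/IH//].
case: m {IH vm} vE => [vE|m vE]; first by move: v1; rewrite vE expr0 ltxx.
by exists m; rewrite vE lexx andbT ltr_eXn2l.
Qed.

Lemma powRXn (a e : R) n : (0 <= a)%R -> ((a ^+ n) `^ e = (a `^ e) ^+ n)%R.
Proof.
move=> a0; rewrite -!powR_mulrn ?powR_ge0// -!powRrM.
by rewrite mulrC.
Qed.

Lemma powR_div (a b e : R) : (0 <= a)%R -> (0 < b)%R ->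
  ((a / b) `^ e = a `^ e / b `^ e)%R.
Proof.
move=> a0 b0; rewrite powRM ?invr_ge0 ?(ltW b0)//; congr *%R.
by rewrite -(powR_inv1 (ltW b0)) -powRrM mulN1r powRN.
Qed.

Lemma le_powRN (a b e : R) : (0 <= e)%R -> (0 < a)%R -> (a <= b)%R ->
  (b `^ (- e) <= a `^ (- e))%R.
Proof.
move=> e0 a0 ab; have b0 := lt_le_trans a0 ab.
rewrite !powRN lef_pV2 ?posrE ?powR_gt0//.
by apply: ge0_ler_powR => //; rewrite nnegrE ltW.
Qed.

Lemma powRNK (a e : R) : (0 < e)%R -> (0 < a)%R ->
  ((a `^ (- e^-1)) `^ (- e) = a)%R.
Proof. by move=> e0 a0; rewrite -powRrM mulrNN mulVf ?gt_eqF// powRr1// ltW. Qed.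

End powers.

(** * Young functions *)

Section convex_functions.
Context {R : realType}.
Variable phi : R -> R.
Hypotheses (phi0 : phi 0 = 0%R) (phi_gt0 : forall r, (0 < r -> 0 < phi r)%R).
Hypothesis phi_cvx : forall x y t : R, (0 <= x)%R -> (0 <= y)%R ->
  (0 <= t <= 1)%R -> (phi (t * x + (1 - t) * y) <= t * phi x + (1 - t) * phi y)%R.

Lemma convex_scale_le t x : (0 <= t <= 1)%R -> (0 <= x)%R ->
  (phi (t * x) <= t * phi x)%R.
Proof.
move=> t01 x0; have := phi_cvx x0 (lexx 0%R) t01.
by rewrite mulr0 phi0 mulr0 !addr0.
Qed.

Lemma convex_ratio_le x y : (0 < x)%R -> (x <= y)%R -> (phi x / x <= phi y / y)%R.
Proof.
move=> x0 xy; have y0 := lt_le_trans x0 xy.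
have t01 : (0 <= x / y <= 1)%R by rewrite divr_ge0 ?(ltW x0) ?(ltW y0)//= ler_pdivrMr// mul1r.
have := convex_scale_le t01 (ltW y0).
rewrite divfK ?gt_eqF// => h; rewrite ler_pdivrMr//.
by rewrite mulrAC -mulrA mulrC.
Qed.

Lemma convex_ge0 x : (0 <= x)%R -> (0 <= phi x)%R.
Proof. by rewrite le_eqVlt => /predU1P[<-|/phi_gt0/ltW//]; rewrite phi0. Qed.

Lemma convex_lt x y : (0 <= x)%R -> (x < y)%R -> (phi x < phi y)%R.
Proof.
rewrite le_eqVlt => /predU1P[<-|x0] xy; first by rewrite phi0 phi_gt0.
have y0 := lt_trans x0 xy.
have := convex_ratio_le x0 (ltW xy).
rewrite ler_pdivrMr// => /le_lt_trans; apply.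
by rewrite -mulrA gtr_pMr ?phi_gt0// mulrC ltr_pdivrMr// mul1r.
Qed.

Lemma convex_le x y : (0 <= x)%R -> (x <= y)%R -> (phi x <= phi y)%R.
Proof.
by move=> x0; rewrite le_eqVlt => /predU1P[->//|xy]; exact/ltW/convex_lt.
Qed.

(** An intermediate value theorem without continuity: [s] is the supremum of a sublevel set, and phi
    s < u as well as phi s > u contradicts a convexity inequality. *)
Lemma convex_surj u : (0 < u)%R -> exists2 s, (0 < s)%R & phi s = u.
Proof.
move=> u0; pose S := [set r : R | (0 <= r)%R /\ (phi r <= u)%R].
have S0 : S 0%R by split => //; rewrite phi0 ltW.
have ubS : has_ubound S.
  (* For r >= 1 the ratio phi r / r is at least phi 1, which bounds r by u / phi 1. *)
  exists (Num.max 1 (u / phi 1))%R => r [r0 ru].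
  rewrite le_max; have [//|r1] := leP r 1%R.
  have := convex_ratio_le ltr01 (ltW r1).
  rewrite divr1 ler_pdivlMr ?(lt_trans ltr01)// => h.
  by rewrite ler_pdivlMr ?phi_gt0// mulrC (le_trans h).
have supS : has_sup S by split => //; exists 0%R.
pose s := sup S; have Sub r : S r -> (r <= s)%R by move=> Sr; apply: ub_le_sup.
have s0 : (0 <= s)%R by exact: Sub.
have us : (u <= phi s)%R.
  rewrite leNgt; apply/negP => su.
  have s1 : (0 <= s + 1)%R by rewrite addr_ge0.
  have us1 : (u < phi (s + 1))%R.
    rewrite ltNge; apply/negP => h; have /Sub := conj s1 h.
    by rewrite gerDl ler10.
  (* The chord from [s] to [s + 1] takes the value [u] at [s + h], so [s + h] would belong to [S]
     although it exceeds the supremum. *)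
  pose h := ((u - phi s) / (phi (s + 1) - phi s))%R.
  have dgt0 : (0 < phi (s + 1) - phi s)%R by lra.
  have h0 : (0 < h)%R by rewrite divr_gt0//; lra.
  have h1 : (h <= 1)%R by rewrite ler_pdivrMr//; lra.
  have h01 : (0 <= h <= 1)%R by rewrite (ltW h0).
  have := phi_cvx s1 s0 h01.
  have -> : (h * (s + 1) + (1 - h) * s = s + h)%R by ring.
  have -> : (h * phi (s + 1) + (1 - h) * phi s = u)%R.
    have := divfK (lt0r_neq0 dgt0) (u - phi s)%R; rewrite -/h; lra.
  move=> hu; have sh : (0 <= s + h)%R by rewrite addr_ge0// ltW.
  by have /Sub := conj sh hu; lra.
have sgt0 : (0 < s)%R.
  rewrite lt_neqAle s0 andbT; apply/eqP => s00.
  by move: us; rewrite -s00 phi0 leNgt u0.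
exists s => //; apply/eqP; rewrite eq_le us andbT leNgt; apply/negP => su.
have s2 : (0 <= 2 * s)%R by rewrite mulr_ge0.
have hs2 : (2 * phi s <= phi (2 * s))%R.
  have h01 : (0 <= (2^-1 : R) <= 1)%R by apply/andP; split; lra.
  by have := convex_scale_le h01 s2; rewrite mulKf//; lra.
(* [s] is a convex combination of [s * (1 - e)], where phi is at most [u], and [2 * s]. For this
   [e], convexity gives phi s - u <= (phi s - u) / 2. *)
pose e := ((phi s - u) / (2 * (phi (2 * s) - phi s)))%R.
have d0 : (0 < 2 * (phi (2 * s) - phi s))%R by lra.
have e0 : (0 < e)%R by rewrite divr_gt0//; lra.
have e1 : (e < 1)%R by rewrite ltr_pdivrMr//; lra.
have [t St rt] : exists2 t, S t & (s * (1 - e) < t)%R.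
  have : (0 < s * e)%R by rewrite mulr_gt0.
  by move=> /sup_adherent -/(_ S supS)[t St tS]; exists t => //; rewrite -/s in tS; lra.
have r0 : (0 <= s * (1 - e))%R by rewrite mulr_ge0//; lra.
have ru : (phi (s * (1 - e)) <= u)%R.
  by case: St => t0 tu; rewrite (le_trans _ tu)// convex_le// ltW.
have l0 : (0 < 1 + e)%R by lra.
have l01 : (0 <= (1 + e)^-1 <= 1)%R.
  by rewrite invr_ge0 (ltW l0)/= invf_le1//; lra.
have := phi_cvx r0 s2 l01.
have -> : ((1 + e)^-1 * (s * (1 - e)) + (1 - (1 + e)^-1) * (2 * s) = s)%R.
  by field; rewrite gt_eqF.
have -> : (1 - (1 + e)^-1 = e / (1 + e))%R by field; rewrite gt_eqF.
rewrite mulrC [X in (_ <= _ + X)%R]mulrAC -mulrDl ler_pdivlMr// => h.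
have eE : (e * (2 * (phi (2 * s) - phi s)) = phi s - u)%R.
  by rewrite divfK// gt_eqF.
have : (0 < phi s - u)%R by lra.
lra.
Qed.

End convex_functions.

Section young.
Context {R : realType}.
Variable Phi : R -> \bar R.
Hypothesis hPhi : young_Y Phi.

Let phi r := fine (Phi r).

Lemma youngE r : (0 <= r)%R -> Phi r = (phi r)%:E.
Proof.
case: hPhi => -[h0 _ _ [P0 _] _] hf; rewrite le_eqVlt => /predU1P[<-|r0].
  by rewrite /phi P0.
by rewrite /phi fineK// gt0_fin_numE; have /andP[] := hf _ r0.
Qed.

Let phi0 : phi 0%R = 0%R.
Proof. by case: hPhi => -[_ _ _ [P0 _] _] _; rewrite /phi P0. Qed.

Let phi_gt0 r : (0 < r)%R -> (0 < phi r)%R.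
Proof.
by move=> r0; rewrite -lte_fin -youngE ?ltW//; case: hPhi => _ /(_ _ r0)/andP[].
Qed.

Let phi_cvx (x y t : R) : (0 <= x)%R -> (0 <= y)%R ->
  (0 <= t <= 1)%R -> (phi (t * x + (1 - t) * y) <= t * phi x + (1 - t) * phi y)%R.
Proof.
move=> x0 y0 t01; case: hPhi => -[_ /(_ _ _ _ x0 y0 t01) + _ _ _] _.
have /andP[t0 t1] := t01.
by rewrite !youngE ?addr_ge0 ?mulr_ge0 ?subr_ge0.
Qed.

Lemma young_fine_gt0 r : (0 < r)%R -> (0 < fine (Phi r))%R.
Proof. exact: phi_gt0. Qed.

Lemma young_fine_ge0 r : (0 <= r)%R -> (0 <= fine (Phi r))%R.
Proof. exact: (convex_ge0 phi0 phi_gt0). Qed.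

Lemma young_fine_lt x y : (0 <= x)%R -> (x < y)%R ->
  (fine (Phi x) < fine (Phi y))%R.
Proof. exact: (convex_lt phi0 phi_gt0 phi_cvx). Qed.

Lemma young_fine_le x y : (0 <= x)%R -> (x <= y)%R ->
  (fine (Phi x) <= fine (Phi y))%R.
Proof. exact: (convex_le phi0 phi_gt0 phi_cvx). Qed.

Lemma young_fine_ratio_le x y : (0 < x)%R -> (x <= y)%R ->
  (fine (Phi x) / x <= fine (Phi y) / y)%R.
Proof. exact: (convex_ratio_le phi0 phi_cvx). Qed.

Lemma young_fine_scale_le t x : (0 <= t <= 1)%R -> (0 <= x)%R ->
  (fine (Phi (t * x)) <= t * fine (Phi x))%R.
Proof. exact: (convex_scale_le phi0 phi_cvx). Qed.

(** Strict monotonicity turns the generalised inverse into a genuine one on the values of [Phi]. *)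
Lemma young_inv_fine s : (0 <= s)%R -> young_inv Phi (fine (Phi s)) = s%:E.
Proof.
move=> s0; rewrite /young_inv; apply/eqP; rewrite eq_le; apply/andP; split.
- apply/lee_addgt0Pr => e e0; apply: ereal_inf_lbound; exists (s + e)%R => //.
  split; first by rewrite addr_ge0// ltW.
  rewrite (@youngE (s + e)%R) ?addr_ge0 ?(ltW e0)// lte_fin young_fine_lt//.
  by rewrite ltrDl.
- apply: le_ereal_inf_tmp => _ [r [r0 sr] <-]; rewrite lee_fin leNgt.
  apply/negP => rs; move: sr; rewrite (@youngE r)// lte_fin ltNge.
  by rewrite young_fine_le// ltW.
Qed.

Lemma young_inv_spec u : (0 < u)%R ->
  exists s, [/\ (0 < s)%R, fine (Phi s) = u & young_inv Phi u = s%:E].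
Proof.
move=> u0; have [s s0 su] := convex_surj phi0 phi_gt0 phi_cvx u0.
by exists s; split => //; rewrite -su young_inv_fine// ltW.
Qed.

Lemma le_young_inv t u : (0 <= t)%R -> (fine (Phi t) <= u)%R ->
  t%:E <= young_inv Phi u.
Proof.
move=> t0 tu; apply: le_ereal_inf_tmp => _ [r [r0 ur] <-].
rewrite lee_fin leNgt; apply/negP => rt; move: ur.
by rewrite youngE// lte_fin ltNge (le_trans _ tu)// young_fine_le// ltW.
Qed.

Lemma young_ext_ge0 x : 0 <= x -> 0 <= young_ext Phi x.
Proof. by case: x => [r| |]//= r0; rewrite youngE// lee_fin young_fine_ge0. Qed.

Lemma young_ext_le x y : 0 <= x -> x <= y -> young_ext Phi x <= young_ext Phi y.
Proof.
case: x y => [r| |] [s| |]//= r0 rs; rewrite ?leey//.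
have s0 : (0 <= s)%R by rewrite -lee_fin (le_trans r0).
by rewrite (youngE r0) (youngE s0) lee_fin young_fine_le.
Qed.

Lemma young_ext_ratio_le (s : R) x : (0 < s)%R -> s%:E <= x ->
  (fine (Phi s) / s)%:E * x <= young_ext Phi x.
Proof.
case: x => [r| |]//= s0 sr; last by rewrite leey.
have r0 : (0 < r)%R by rewrite -lte_fin (lt_le_trans _ sr).
rewrite (youngE (ltW r0)) -?EFinM lee_fin -ler_pdivlMr//.
exact: young_fine_ratio_le.
Qed.

Lemma young_ext_scale_le (N : R) x : (1 <= N)%R -> 0 <= x ->
  young_ext Phi (N^-1%:E * x) <= N^-1%:E * young_ext Phi x.
Proof.
move=> N1; have N0 : (0 < N)%R by rewrite (lt_le_trans ltr01).
case: x => [r| |]//= r0; last by rewrite gt0_muley ?lte_fin ?invr_gt0.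
rewrite (@youngE r)// (@youngE (N^-1 * r)%R) ?mulr_ge0 ?invr_ge0 ?(ltW N0)//.
rewrite -?EFinM lee_fin.
by apply: young_fine_scale_le => //; rewrite invr_ge0 (ltW N0)/= invf_le1.
Qed.

Lemma young_ext_measurable d (T : measurableType d) (f : T -> \bar R) :
  (forall x, 0 <= f x) -> measurable_fun setT f ->
  measurable_fun setT (fun x => young_ext Phi (f x)).
Proof.
move=> f0 mf.
(* The values of [Phi] at negative arguments are arbitrary. Truncating the argument at 0 gives a
   function monotone on all of [R], hence measurable. *)
have -> : (fun x => young_ext Phi (f x)) =
    er_map (fun r => fine (Phi (Num.max 0 r)))%R \o f.
  apply/funext => x /=; have := f0 x; case: (f x) => [r| |]//= r0.
  by rewrite youngE// max_r.
apply: measurableT_comp => //; apply: (measurable_er_map T).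
apply: nondecreasing_measurable => // x y xy.
apply: young_fine_le; first by rewrite le_max lexx.
by rewrite ge_max !le_max lexx xy orbT.
Qed.

End young.

(** * Comparison of dyadic sums with integrals *)

Section dyadic_sum.
Context {R : realType}.
Notation leb := (@lebesgue_measure R).

(** On each dyadic interval the monotone factors t^alpha, t^-1 and F t are bounded below by their
    end point values. This converts sums over dyadic balls into the integral of the hypothesis. *)
Lemma dyadic_sum_le_integral (F : R -> R) (alpha r : R) :
  (0 <= alpha)%R -> (0 < r)%R -> (forall t, (0 < t)%R -> (0 <= F t)%R) ->
  (forall t u, (0 < t)%R -> (t <= u)%R -> (F u <= F t)%R) ->
  \sum_(k <oo) ((2 ^+ k * r) `^ alpha * F (2 ^+ k.+1 * r))%:E <=
  2%:E * \int[leb]_(t in `[r, +oo[) (t `^ (alpha - 1) * F t)%:E.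
Proof.
move=> a0 r0 F0 Fd.
pose I k : set R := `[(2 ^+ k * r)%R, (2 ^+ k.+1 * r)%R[%classic.
have p2 k : (0 < 2 ^+ k * r)%R by rewrite mulr_gt0// exprn_gt0.
have rI k t : I k t -> (r <= t)%R.
  rewrite /I/= in_itv/= => /andP[h _]; rewrite (le_trans _ h)//.
  by rewrite ler_peMl ?(ltW r0)// exprn_ege1// ler1n.
have mF : measurable_fun `[r, +oo[ (fun t => (t `^ (alpha - 1) * F t)%:E).
  apply/measurable_EFinP; apply: measurable_funM.
    exact: measurable_funTS (measurable_powR _).
  (* [F] is monotone only on positive arguments; freezing it to the left of [r] makes it monotone
     everywhere. *)
  apply: (eq_measurable_fun (fun t => F (Num.max r t))).
    by move=> t; rewrite inE/= in_itv/= andbT => rt; rewrite max_r.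
  apply: nonincreasing_measurable => // x y xy.
  apply: Fd; first by rewrite lt_max r0.
  by rewrite ge_max le_max lexx/= le_max xy orbT.
have F0' t : (r <= t)%R -> 0 <= (t `^ (alpha - 1) * F t)%:E.
  by move=> rt; rewrite lee_fin mulr_ge0 ?powR_ge0// F0// (lt_le_trans r0).
have sI : \bigcup_k I k `<=` `[r, +oo[.
  by move=> t [k _ /rI]; rewrite /= in_itv/= andbT.
have mI : measurable (\bigcup_k I k) by apply: bigcup_measurable => k _; exact: measurable_itv.
have tI : trivIset setT I.
  apply/trivIsetP => i j _ _; wlog ij : i j / (i < j)%N.
    move=> h; rewrite neq_ltn => /orP[ij|ji]; first by apply: h; rewrite ?ltn_eqF.
    by rewrite setIC; apply: h; rewrite ?ltn_eqF.
  move=> _; apply/seteqP; split=> // t [].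
  rewrite /I/= !in_itv/= => /andP[_ ti] /andP[tj _].
  have : (2 ^+ i.+1 * r <= 2 ^+ j * r)%R.
    by rewrite ler_pM2r// ler_eXn2l// ltr1n.
  by move=> /(lt_le_trans ti) /lt_le_trans/(_ tj); rewrite ltxx.
apply: (@le_trans _ _ (2%:E * \int[leb]_(t in \bigcup_k I k) (t `^ (alpha - 1) * F t)%:E)); last first.
  rewrite lee_pmul2l//; apply: ge0_subset_integral => //.
  by move=> t /=; rewrite in_itv/= andbT; exact: F0'.
rewrite ge0_integral_bigcup//; last 3 first.
- by move=> k; exact: measurable_itv.
- exact: measurable_funS mF.
- by move=> t /sI/=; rewrite in_itv/= andbT; exact: F0'.
rewrite -nneseriesZl; last first.
  by move=> k _; apply: integral_ge0 => t /rI; exact: F0'.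
apply: lee_nneseries => k _.
  by rewrite lee_fin mulr_ge0 ?powR_ge0// F0.
rewrite muleC -lee_pdivrMr// -EFinM.
(* The interval has length 2^k r, whereas t^-1 is bounded below by (2^(k+1) r)^-1: this accounts for
   the factor 2. *)
pose c := ((2 ^+ k.+1 * r)^-1 * (2 ^+ k * r) `^ alpha * F (2 ^+ k.+1 * r))%R.
have -> : ((2 ^+ k * r) `^ alpha * F (2 ^+ k.+1 * r) / 2)%:E = c%:E * leb (I k).
  rewrite /I lebesgue_measure_itv/= lte_fin ltr_pM2r// exprS.
  rewrite ltr_pMl ?exprn_gt0// ltr1n -EFinD -EFinM; congr EFin.
  by rewrite /c exprS; field; rewrite (gt_eqF r0) gt_eqF// exprn_gt0.
rewrite -integral_cst; last exact: measurable_itv.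
apply: ge0_le_lower_integral => t It.
  by rewrite lee_fin /c !mulr_ge0 ?invr_ge0 ?powR_ge0 ?F0// ltW.
have t0 : (0 < t)%R by rewrite (lt_le_trans r0)// (rI k).
move: It; rewrite /I/= in_itv/= => /andP[kt tk].
rewrite lee_fin /c; apply: ler_pM; rewrite ?mulr_ge0 ?invr_ge0 ?powR_ge0 ?F0 ?(ltW (p2 _))//; last exact/Fd/ltW.
rewrite powRB; last by rewrite (gt_eqF t0) implybT.
rewrite powRr1 ?(ltW t0)// mulrC; apply: ler_pM; rewrite ?powR_ge0 ?invr_ge0 ?(ltW (p2 _))//.
  by rewrite ge0_ler_powR// nnegrE ltW.
by rewrite lef_pV2 ?posrE// ltW.
Qed.

End dyadic_sum.

(** * Covers of Q-homogeneous spaces *)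

Section geometry.
Context {R : realType} {disp : measure_display} {X : topMeasurableType disp}.
Variables (d : X -> X -> R) (mu : {measure set X -> \bar R}) (Q K1 K3 : R).
Hypothesis d_ge0 : forall x y, (0 <= d x y)%R.
Hypothesis d_sym : forall x y, d x y = d y x.
Hypothesis K1_ge1 : (1 <= K1)%R.
Hypothesis d_triangle : forall x y z, (d x y <= K1 * (d x z + d z y))%R.
Hypothesis mball : forall x r, (0 < r)%R -> measurable (qball d x r).
Hypothesis K3_ge1 : (1 <= K3)%R.
Hypothesis ball_growth : forall x r, (0 < r)%R ->
  (K3^-1 * r `^ Q)%:E <= mu (qball d x r) <= (K3 * r `^ Q)%:E.

Let K1_gt0 : (0 < K1)%R. Proof. exact: lt_le_trans ltr01 K1_ge1. Qed.
Let K3_gt0 : (0 < K3)%R. Proof. exact: lt_le_trans ltr01 K3_ge1. Qed.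

Lemma ball_triangle (a b : R) x y z :
  (d x z < a)%R -> (d z y < b)%R -> (d x y < K1 * (a + b))%R.
Proof.
by move=> xz zy; rewrite (le_lt_trans (d_triangle x y z))// ltr_pM2l// ltrD.
Qed.

Lemma qball_nonpos x r : (r <= 0)%R -> qball d x r = set0.
Proof.
move=> r0; apply/seteqP; split => // y; rewrite /qball/= => /lt_le_trans/(_ r0).
by rewrite ltNge d_ge0.
Qed.

Lemma measurable_dist x : measurable_fun setT (d x).
Proof.
apply: (measurability _ (RGenInftyO.measurableE R)) => _ [_ [r ->] <-].
rewrite setTI (_ : _ @^-1` _ = qball d x r); last first.
  by apply/seteqP; split => y; rewrite /qball/= in_itv.
by have [/mball//|/qball_nonpos->] := ltP 0%R r.
Qed.

(** The balls are disjoint: by the quasi-triangle inequality a common point would put two centres at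
    distance less than K1 (2 e / (2 K1)) = e. *)
Lemma measure_separated_balls (e : R) (s : seq X) : (0 < e)%R ->
  pairwise (fun a b => e <= d a b)%R s ->
  ((size s)%:R * (K3^-1 * (e / (2 * K1)) `^ Q))%:E <=
  mu (\big[setU/set0]_(c <- s) qball d c (e / (2 * K1))).
Proof.
move=> e0; have del0 : (0 < e / (2 * K1))%R by rewrite divr_gt0// mulr_gt0.
elim: s => [|a s IH]; first by rewrite big_nil mul0r measure0.
rewrite /= => /andP[/allP ha ps]; rewrite big_cons measureU.
- rewrite -natr1 mulrDl mul1r addrC EFinD leeD ?IH//.
  by case/andP: (ball_growth a del0).
- exact: mball.
- by apply: bigsetU_measurable => c _; exact: mball.
- apply/seteqP; split => // y [ay].
  rewrite -bigcup_seq => -[c /= cs cy].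
  rewrite /qball/= in ay cy; rewrite d_sym in cy.
  have := ball_triangle ay cy.
  rewrite (_ : K1 * _ = e)%R; last by field; rewrite gt_eqF.
  by rewrite ltNge ha.
Qed.

(** Otherwise a greedy choice produces arbitrarily many [e]-separated points in the ball. The small
    disjoint balls around them all have measure at least [v] and lie in one ball of measure at most
    [V]. *)
Lemma finite_net x0 (rho e : R) : (0 < rho)%R -> (0 < e)%R ->
  exists s : seq X, forall y, (d x0 y < rho)%R ->
    exists2 c, c \in s & (d c y < e)%R.
Proof.
move=> rho0 e0; apply: contrapT => /forallNP nets.
have sep m : exists s : seq X, [/\ size s = m,
    pairwise (fun a b => e <= d a b)%R s & {in s, forall c, (d x0 c < rho)%R}].
  elim: m => [|m [s [sm ps srho]]]; first by exists [::].
  have /existsNP[y /not_implyP[yrho ys]] := nets s.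
  exists (y :: s); split; first by rewrite /= sm.
    rewrite /= ps andbT; apply/allP => c cs; rewrite leNgt; apply/negP => yc.
    by apply: ys; exists c => //; rewrite d_sym.
  by move=> c; rewrite inE => /predU1P[->|/srho].
pose del := (e / (2 * K1))%R.
have del0 : (0 < del)%R by rewrite divr_gt0// mulr_gt0.
pose v := (K3^-1 * del `^ Q)%R.
have v0 : (0 < v)%R by rewrite mulr_gt0 ?invr_gt0// powR_gt0.
have rd0 : (0 < K1 * (rho + del))%R by rewrite mulr_gt0// addr_gt0.
pose V := (K3 * (K1 * (rho + del)) `^ Q)%R.
have [s [sm ps srho]] := sep (Num.truncn (V / v)).+1.
have mU : measurable (\big[setU/set0]_(c <- s) qball d c del).
  by apply: bigsetU_measurable => c _; exact: mball.
have : ((size s)%:R * v)%:E <= V%:E.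
  apply: le_trans (measure_separated_balls e0 ps) _.
  case/andP: (ball_growth x0 rd0) => _; apply: le_trans.
  apply: le_measure; rewrite ?inE//; first exact: mball.
  rewrite -bigcup_seq => y [c /= /srho cs cy].
  exact: ball_triangle cs cy.
by rewrite sm lee_fin -ler_pdivlMr// leNgt truncnS_gt.
Qed.

Lemma countable_net (x0 : X) (e : R) : (0 < e)%R ->
  exists c : nat -> X, forall y, exists i, (d (c i) y < e)%R.
Proof.
move=> e0; have n0 n : (0 < n.+1%:R :> R)%R by [].
have [s hs] := choice (fun n => finite_net x0 (n0 n) e0).
(* Union of the finite nets of the balls around [x0] of radius 1, 2, ...; an index encodes a pair
   (radius, position in the net), and the default values are harmless. *)
exists (fun i => let p := odflt (0, 0)%N (unpickle i) in nth x0 (s p.1) p.2).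
move=> y; have [c cs cy] := hs _ _ (truncnS_gt (d x0 y)).
exists (pickle (Num.truncn (d x0 y), index c (s (Num.truncn (d x0 y))))).
by rewrite pickleK/= nth_index.
Qed.

(* The constant comes from a cover by balls B(c_i, rho) made disjoint: a point
   y lies in B(c_i, 2 K1 rho) only for pieces contained in B(y, 3 K1^2 rho). *)
Lemma ball_integral_majorant (x0 : X) (rho : R) (h : X -> \bar R) :
  (0 < rho)%R -> (forall x, 0 <= h x) -> measurable_fun setT h ->
  exists A : X -> \bar R, [/\ forall x, 0 <= A x, measurable_fun setT A,
    forall x, \int[mu]_(y in qball d x rho) h y <= A x &
    \int[mu]_x A x <= (K3 * (3 * K1 ^+ 2 * rho) `^ Q)%:E * \int[mu]_x h x].
Proof.
move=> rho0 h0 mh; have [c hc] := countable_net x0 rho0.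
pose P := seqDU (fun i => qball d (c i) rho).
pose B i := qball d (c i) (2 * K1 * rho).
have mP i : measurable (P i).
  apply: measurableD; first exact: mball.
  by apply: bigsetU_measurable => j _; exact: mball.
have Krho0 : (0 < 2 * K1 * rho)%R by rewrite !mulr_gt0.
have mB i : measurable (B i) by exact: mball.
have I0 i : 0 <= \int[mu]_(y in B i) h y by apply: integral_ge0.
pose a i x := (\1_(P i) x)%:E * \int[mu]_(y in B i) h y.
have a0 i x : 0 <= a i x by rewrite mule_ge0// lee_fin.
have ma i : measurable_fun setT (a i).
  apply: emeasurable_funM => //; apply/measurable_EFinP.
  exact: measurable_indic.
have mhB i : measurable_fun setT (h \_ (B i)).
  by apply/(measurable_restrictT _ (mB i)); exact: measurable_funTS.
have hB0 i y : 0 <= (h \_ (B i)) y by exact: erestrict_ge0.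
have R0 : (0 < 3 * K1 ^+ 2 * rho)%R by rewrite !mulr_gt0// exprn_gt0.
exists (fun x => \sum_(i <oo) a i x); split.
- by move=> x; apply: nneseries_ge0.
- exact: ge0_measurable_nneseries.
(* If [x] lies in the piece [P i], the quasi-triangle inequality puts the ball of radius [rho]
   around [x] inside [B i]. *)
- move=> x; have [i _ Pix] : (\bigcup_i P i) x.
    rewrite -seqDU_bigcup_eq; have [i ci] := hc x.
    by exists i.
  apply: le_trans (nneseries_ge_term i _) => //.
  rewrite /a indicE mem_set// mul1e; apply: ge0_subset_integral => //.
  + exact: mball.
  + exact: measurable_funTS.
  + move=> y xy; have /ball_triangle := subset_seqDU Pix.
    move=> /(_ _ _ xy); rewrite /B /qball/= => /lt_le_trans; apply.
    by rewrite le_eqVlt; apply/orP; left; apply/eqP; ring.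
- rewrite integral_nneseries//.
  (* Tonelli: the integrals over the [B i], weighted by the measures of the pieces, are regrouped
     into one integral of a multiple of [h]. *)
  have -> : \sum_(i <oo) \int[mu]_x a i x =
      \sum_(i <oo) \int[mu]_y (mu (P i) * (h \_ (B i)) y).
    apply: eq_eseriesr => i _; rewrite /a ge0_integralZr//; last first.
      by apply/measurable_EFinP; exact: measurable_indic.
    rewrite integral_indic// setIT.
    by rewrite ge0_integralZl// -integral_mkcond.
  rewrite -integral_nneseries//; last 2 first.
  - by move=> i; apply: emeasurable_funM => //; exact: measurable_cst.
  - by move=> i y _; rewrite mule_ge0.
  rewrite -ge0_integralZl_EFin//; last first.
    by rewrite mulr_ge0 ?powR_ge0// ltW.
  apply: ge0_le_lower_integral => y _.
    by apply: nneseries_ge0 => i _ _; rewrite mule_ge0.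
  apply: nneseries_le_bound => [i|n]; first by rewrite mule_ge0.
  (* Only pieces whose enlarged ball contains [y] count at [y]. They are disjoint, so their total
     measure is at most that of one ball around [y]. *)
  pose P' i := if y \in B i then P i else set0.
  have mP' i : measurable (P' i) by rewrite /P'; case: ifP.
  have tP' : trivIset setT P'.
    have /trivIsetP tP := @trivIset_seqDU _ (fun i => qball d (c i) rho).
    apply/trivIsetP => i j _ _ ij; rewrite /P'.
    by case: ifP => _; case: ifP => _; rewrite ?set0I ?setI0//; apply: tP.
  have -> : \sum_(0 <= i < n) mu (P i) * (h \_ (B i)) y =
      (\sum_(0 <= i < n) mu (P' i)) * h y.
    rewrite ge0_sume_distrl//; apply: eq_bigr => i _.
    by rewrite patchE /P'; case: ifP; rewrite ?mule0// measure0 mul0e.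
  apply: lee_wpmul2r => //.
  apply: (@le_trans _ _ (mu (qball d y (3 * K1 ^+ 2 * rho)))); last first.
    by case/andP: (ball_growth y R0).
  apply: (@le_trans _ _ (\sum_(i <oo) mu (P' i))).
    exact: nneseries_lim_ge.
  rewrite -measure_semi_bigcup//; last exact: bigcup_measurable.
  apply: le_measure; rewrite ?inE//.
  + exact: bigcup_measurable.
  + exact: mball.
  + move=> z [i _]; rewrite /P'; case: ifP => // /[!inE] yB Piz.
    have cz := subset_seqDU Piz.
    rewrite /B /qball/= d_sym in yB; rewrite /qball/= in cz.
    have := ball_triangle yB cz.
    rewrite /qball/= => /lt_le_trans; apply.
    have : (0 <= (K1 - 1) * K1 * rho)%R.
      by rewrite !mulr_ge0 ?subr_ge0// ltW.
    by move: rho0 K1_ge1; nra.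
Qed.

End geometry.

(** * The kernel *)

Section kernel.
Context {R : realType} {disp : measure_display} {X : topMeasurableType disp}.
Variables (d : X -> X -> R) (mu : {measure set X -> \bar R}) (Q alpha : R).
Hypothesis d_ge0 : forall x y, (0 <= d x y)%R.
Hypothesis mball : forall x r, (0 < r)%R -> measurable (qball d x r).
Hypothesis alphaQ : (alpha < Q)%R.

Let beta := (Q - alpha)%R.
Let beta_gt0 : (0 < beta)%R. Proof. by rewrite subr_gt0. Qed.
Notation I := (fractional_integral d mu Q alpha).
Let ker x y : \bar R := ((d x y `^ beta)%:E)^-1.

(** At distance zero the inverse in [\bar R] is [+oo], while the real power with exponent [- beta]
    would be 0; hence the case distinction. *)
Let kerE x y : ker x y = if d x y == 0%R then +oo else (d x y `^ (- beta))%:E.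
Proof. by rewrite /ker inver powR_eq0 (gt_eqF beta_gt0) andbT powRN. Qed.

Lemma riesz_kernel_measurable x :
  measurable_fun setT (fun y => ((d x y `^ (Q - alpha))%:E)^-1 : \bar R).
Proof.
rewrite (_ : (fun _ => _) = fun y =>
    if d x y == 0%R then +oo else (d x y `^ (- beta))%:E); last first.
  by apply/funext => y; exact: kerE.
have md := measurable_dist d_ge0 mball x.
apply: measurable_fun_ifT => //; first exact: measurable_fun_eqr.
apply/measurable_EFinP.
exact: (measurableT_comp (measurable_powR (- beta)) md).
Qed.

Let ker_ge0 x y : 0 <= ker x y.
Proof. by rewrite inve_ge0 lee_fin powR_ge0. Qed.

Lemma abse_fractional_integral_le f x : measurable_fun setT f ->
  `|I f x| <= I (fun y => `|f y|) x.
Proof.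
move=> mf; apply: le_trans (le_abse_integral _ _ _) _ => //.
  by apply: emeasurable_funM => //; exact: riesz_kernel_measurable.
rewrite /fractional_integral le_eqVlt; apply/orP; left; apply/eqP.
by apply: eq_integral => y _; rewrite abseM (gee0_abs (ker_ge0 x y)).
Qed.

Lemma fractional_integralZl (c : R) g x : (0 <= c)%R ->
  (forall y, 0 <= g y) -> measurable_fun setT g ->
  I (fun y => c%:E * g y) x = c%:E * I g x.
Proof.
move=> c0 g0 mg; rewrite /fractional_integral.
under eq_integral do rewrite -muleA.
rewrite ge0_integralZl_EFin// => [y _|]; first by rewrite mule_ge0// ker_ge0.
by apply: emeasurable_funM => //; exact: riesz_kernel_measurable.
Qed.

Let ker_le x y u : (0 < u)%R -> (u <= d x y)%R -> ker x y <= (u `^ (- beta))%:E.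
Proof.
move=> u0 ud; rewrite kerE gt_eqF ?(lt_le_trans u0)// lee_fin.
by rewrite le_powRN// ltW.
Qed.

(* On the diagonal the kernel is [+oo], and so is the first series. *)
Lemma kernel_le_dyadic x y (r : R) (c : \bar R) : (0 < r)%R -> 0 <= c ->
  c / (d x y `^ (Q - alpha))%:E <=
  \sum_(k <oo) ((r / 2 ^+ k.+1) `^ (- beta))%:E * (cst c \_ (qball d x (r / 2 ^+ k))) y
  + \sum_(k <oo) ((2 ^+ k * r) `^ (- beta))%:E * (cst c \_ (qball d x (2 ^+ k.+1 * r))) y.
Proof.
move=> r0 c0; rewrite -/(ker x y).
have two : (1 < 2 :> R)%R by rewrite ltr1n.
have p2 k : (0 < 2 ^+ k :> R)%R by rewrite exprn_gt0.
have cst0 A z : 0 <= (cst c \_ A) z by apply: erestrict_ge0.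
have lo0 k : 0 <= ((r / 2 ^+ k.+1) `^ (- beta))%:E *
    (cst c \_ (qball d x (r / 2 ^+ k))) y.
  by rewrite mule_ge0// lee_fin powR_ge0.
have hi0 k : 0 <= ((2 ^+ k * r) `^ (- beta))%:E *
    (cst c \_ (qball d x (2 ^+ k.+1 * r))) y.
  by rewrite mule_ge0// lee_fin powR_ge0.
(* Off the diagonal, [y] lies in one dyadic annulus around [x], and the corresponding term of one of
   the series suffices. *)
have [dr|rd] := ltP (d x y) r; last first.
  apply: le_trans (leeDr _ _); last exact: nneseries_ge0.
  have v1 : (1 <= d x y / r)%R by rewrite ler_pdivlMr// mul1r.
  have [n /andP[nv vn]] := exists_expr_bracket two v1.
  apply: le_trans (nneseries_ge_term n _) => //.
  rewrite patchE mem_set; last by rewrite /qball/= -ltr_pdivrMr.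
  rewrite muleC; apply: lee_wpmul2r => //.
  by apply: ker_le; rewrite ?mulr_gt0// -ler_pdivlMr.
apply: le_trans (leeDl _ _); last exact: nneseries_ge0.
move: (d_ge0 x y); rewrite le_eqVlt => /predU1P[d0|d0]; last first.
  have v1 : (1 < r / d x y)%R by rewrite ltr_pdivlMr// mul1r.
  have [n /andP[nv vn]] := exists_expr_bracket_lt two v1.
  apply: le_trans (nneseries_ge_term n _) => //.
  rewrite patchE mem_set; last first.
    by rewrite /qball/= ltr_pdivlMr// mulrC -ltr_pdivlMr.
  rewrite muleC; apply: lee_wpmul2r => //.
  by apply: ker_le; rewrite ?divr_gt0// ler_pdivrMr// mulrC -ler_pdivrMr.
move: c0; rewrite le_eqVlt => /predU1P[c0|cgt0].
  by rewrite -{1}c0 mul0e; apply: nneseries_ge0.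
(* On the diagonal all the balls contain [y], and the weights grow like powers of 2^beta, so the
   first series diverges for [c] > 0. *)
rewrite nneseries_unbounded ?leey// => M.
have b1 : (1 < 2 `^ beta :> R)%R.
  have := @gt0_ltr_powR _ beta beta_gt0 1%R 2%R.
  by rewrite !nnegrE powR1; apply.
have inB n : y \in qball d x (r / 2 ^+ n).
  by rewrite inE /qball/= -d0 divr_gt0.
have [e e0 ec] : exists2 e : R, (0 < e)%R & e%:E <= c.
- case: c cgt0 {cst0 lo0 hi0} => [e| |]//; last by exists 1%R; rewrite ?leey.
  by rewrite lte_fin; exists e.
have [n Mn] := exists_lt_expr (M / e * r `^ beta) b1.
exists n; rewrite patchE inB.
apply: (@le_trans _ _ (((r / 2 ^+ n.+1) `^ (- beta))%:E * e%:E)); last first.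
  by apply: lee_wpmul2l => //; rewrite lee_fin powR_ge0.
rewrite -EFinM lee_fin -ler_pdivrMr// powRN powR_div ?(ltW r0)// invf_div.
rewrite ler_pdivlMr ?powR_gt0// (le_trans (ltW Mn))// powRXn//.
by rewrite ler_eXn2l.
Qed.

(** [kernel_le_dyadic] with [c := g y] is integrated in [y], both series being integrated term by
    term. *)
Lemma fractional_integral_le_dyadic g x (r : R) : (0 < r)%R ->
  (forall y, 0 <= g y) -> measurable_fun setT g ->
  I g x <=
  \sum_(k <oo) ((r / 2 ^+ k.+1) `^ (alpha - Q))%:E *
     \int[mu]_(y in qball d x (r / 2 ^+ k)) g y
  + \sum_(k <oo) ((2 ^+ k * r) `^ (alpha - Q))%:E *
     \int[mu]_(y in qball d x (2 ^+ k.+1 * r)) g y.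
Proof.
move=> r0 g0 mg.
have p2 k : (0 < 2 ^+ k :> R)%R by rewrite exprn_gt0.
have mg_ A : measurable A -> measurable_fun setT (g \_ A).
  by move=> mA; apply/(measurable_restrictT _ mA); exact: measurable_funTS.
have g_0 A z : 0 <= (g \_ A) z by apply: erestrict_ge0.
have seriesE (c rho : nat -> R) : (forall k, 0 <= c k)%R -> (forall k, 0 < rho k)%R ->
    \sum_(k <oo) (c k)%:E * \int[mu]_(y in qball d x (rho k)) g y =
    \int[mu]_y \sum_(k <oo) (c k)%:E * (g \_ (qball d x (rho k))) y /\
    measurable_fun setT (fun y => \sum_(k <oo) (c k)%:E * (g \_ (qball d x (rho k))) y).
  move=> c0 rho0.
  have cg0 k y : 0 <= (c k)%:E * (g \_ (qball d x (rho k))) y.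
    by rewrite mule_ge0// lee_fin.
  have mcg k : measurable_fun setT (fun y => (c k)%:E * (g \_ (qball d x (rho k))) y).
    by apply: emeasurable_funM => //; exact/mg_/mball.
  split; last exact: ge0_measurable_nneseries.
  rewrite integral_nneseries//; apply: eq_eseriesr => k _.
  by rewrite ge0_integralZl_EFin// -?integral_mkcond//; exact/mg_/mball.
have rk k : (0 < r / 2 ^+ k)%R by rewrite divr_gt0.
have kr k : (0 < 2 ^+ k.+1 * r)%R by rewrite mulr_gt0.
have [-> m1] := seriesE _ _ (fun k => powR_ge0 (r / 2 ^+ k.+1) (alpha - Q)) rk.
have [-> m2] := seriesE _ _ (fun k => powR_ge0 (2 ^+ k * r) (alpha - Q)) kr.
rewrite -ge0_integralD//; last 2 first.
- by move=> y _; apply: nneseries_ge0 => k _ _; rewrite mule_ge0// lee_fin powR_ge0.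
- by move=> y _; apply: nneseries_ge0 => k _ _; rewrite mule_ge0// lee_fin powR_ge0.
apply: ge0_le_lower_integral => y _; first by rewrite mule_ge0// ker_ge0.
have := @kernel_le_dyadic x y r (g y) r0 (g0 y).
by rewrite /beta opprB.
Qed.

End kernel.

(** * The pointwise estimate *)

Section level_sets.
Context {R : realType} {disp : measure_display} {T : measurableType disp}.
Variables (mu : {measure set T -> \bar R}) (Phi : R -> \bar R) (g : T -> \bar R).
Hypothesis hPhi : young_Y Phi.
Hypotheses (g0 : forall y, 0 <= g y) (mg : measurable_fun setT g).
Variables (s : R).
Hypothesis s_gt0 : (0 < s)%R.

Lemma superlevel_measurable : measurable [set y | s%:E < g y].
Proof. by rewrite -[X in measurable X]setTI; exact: emeasurable_fun_o_infty. Qed.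

Lemma superlevel_part_ge0 y : 0 <= (g \_ [set y | s%:E < g y]) y.
Proof. exact: erestrict_ge0. Qed.

Lemma superlevel_part_measurable : measurable_fun setT (g \_ [set y | s%:E < g y]).
Proof.
apply/(measurable_restrictT _ superlevel_measurable).
exact: measurable_funTS.
Qed.

(** Pointwise, g <= s + g 1_{g > s}. *)
Lemma integral_le_level_split A : measurable A ->
  \int[mu]_(y in A) g y <=
  s%:E * mu A + \int[mu]_(y in A) (g \_ [set y | s%:E < g y]) y.
Proof.
move=> mA; rewrite -integral_cst// -ge0_integralD//; last 3 first.
- by move=> y _; rewrite lee_fin ltW.
- by move=> y _; exact: superlevel_part_ge0.
- exact/measurable_funTS/superlevel_part_measurable.
apply: ge0_le_lower_integral => // y _; rewrite patchE.
case: ifPn; rewrite ?notin_setE ?inE/= => h; first by rewrite leeDr// lee_fin ltW.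
by rewrite adde0 leNgt; apply/negP.
Qed.

(** Since Phi(t) / t is nondecreasing, (Phi(s) / s) g <= Phi(g) wherever g > s. *)
Lemma integral_superlevel_le :
  (fine (Phi s) / s)%:E * \int[mu]_y (g \_ [set y | s%:E < g y]) y <=
  \int[mu]_y young_ext Phi (g y).
Proof.
have c0 : (0 <= fine (Phi s) / s)%R.
  by rewrite divr_ge0// ?young_fine_ge0// ltW.
rewrite -ge0_integralZl_EFin//; last 2 first.
- by move=> y _; exact: superlevel_part_ge0.
- exact: superlevel_part_measurable.
apply: ge0_le_lower_integral => y _.
  by rewrite mule_ge0 ?superlevel_part_ge0.
rewrite patchE; case: ifPn; rewrite ?inE/= => h.
  by apply: young_ext_ratio_le => //; exact: ltW.
by rewrite mule0 young_ext_ge0.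
Qed.

Lemma integral_superlevel_le1 : \int[mu]_y young_ext Phi (g y) <= 1 ->
  \int[mu]_y (g \_ [set y | s%:E < g y]) y <= (s / fine (Phi s))%:E.
Proof.
move=> h; have := le_trans integral_superlevel_le h.
have p0 := young_fine_gt0 hPhi s_gt0.
rewrite -lee_pdivlMl ?divr_gt0// => /le_trans; apply.
by rewrite mule1 invf_div.
Qed.

End level_sets.

(** * Near and far parts of the fractional integral *)

Section hedberg.
Context {R : realType} {disp : measure_display} {X : topMeasurableType disp}.
Variables (d : X -> X -> R) (mu : {measure set X -> \bar R}) (Q K1 K3 : R).
Hypothesis d_ge0 : forall x y, (0 <= d x y)%R.
Hypothesis d_sym : forall x y, d x y = d y x.
Hypothesis K1_ge1 : (1 <= K1)%R.
Hypothesis d_triangle : forall x y z, (d x y <= K1 * (d x z + d z y))%R.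
Hypothesis mball : forall x r, (0 < r)%R -> measurable (qball d x r).
Hypothesis K3_ge1 : (1 <= K3)%R.
Hypothesis ball_growth : forall x r, (0 < r)%R ->
  (K3^-1 * r `^ Q)%:E <= mu (qball d x r) <= (K3 * r `^ Q)%:E.
Variables (alpha A : R) (Phi : R -> \bar R).
Hypotheses (Q_gt0 : (0 < Q)%R) (alpha_gt0 : (0 < alpha)%R) (alphaQ : (alpha < Q)%R).
Hypothesis hPhi : young_Y Phi.
Hypotheses (A_gt0 : (0 < A)%R) (hint : forall r : R, (0 < r)%R ->
       \int[lebesgue_measure]_(t in `[r, +oo[)
          ((t `^ (alpha - 1))%:E * young_inv Phi (t `^ (- Q)))
       <= A%:E * ((r `^ alpha)%:E * young_inv Phi (r `^ (- Q)))).
Notation I := (fractional_integral d mu Q alpha).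

Let K3_gt0 : (0 < K3)%R. Proof. exact: lt_le_trans ltr01 K3_ge1. Qed.

(** The cutting level adapted to radius [t]: there [Phi] takes the value t^-Q, comparable to the
    reciprocal of the measure of a ball of radius [t]. *)
Let sig (t : R) := fine (young_inv Phi (t `^ (- Q))).

Let sigP t : (0 < t)%R -> [/\ (0 < sig t)%R, fine (Phi (sig t)) = (t `^ (- Q))%R &
  young_inv Phi (t `^ (- Q)) = (sig t)%:E].
Proof.
move=> t0; have [s [s0 sE sI]] := young_inv_spec hPhi (powR_gt0 (- Q) t0).
by rewrite /sig sI.
Qed.

Let sig_anti t u : (0 < t)%R -> (t <= u)%R -> (sig u <= sig t)%R.
Proof.
move=> t0 tu; have u0 := lt_le_trans t0 tu; rewrite leNgt; apply/negP.
have [st pt _] := sigP t0; have [su pu _] := sigP u0.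
move=> /(young_fine_lt hPhi (ltW st)); rewrite pt pu ltNge.
by rewrite le_powRN// ltW.
Qed.

(** Cutting at the level [sig rho], the lower part contributes at most K3 rho^Q times the level and
    the upper part at most sig rho / Phi (sig rho) = rho^Q sig rho. *)
Lemma ball_integral_le g x (rho : R) : (0 < rho)%R ->
  (forall y, 0 <= g y) -> measurable_fun setT g ->
  \int[mu]_y young_ext Phi (g y) <= 1 ->
  \int[mu]_(y in qball d x rho) g y <=
  ((K3 + 1) * rho `^ Q * fine (young_inv Phi (rho `^ (- Q))))%:E.
Proof.
move=> rho0 g0 mg g1; rewrite -/(sig rho).
have [s0 sE _] := sigP rho0.
apply: le_trans (integral_le_level_split mu g0 mg s0 (mball x rho0)) _.
rewrite -mulrA mulrDl mul1r EFinD; apply: leeD.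
  apply: (@le_trans _ _ ((sig rho)%:E * (K3 * rho `^ Q)%:E)).
    by rewrite lee_pmul2l//; case/andP: (ball_growth x rho0).
  by rewrite -EFinM lee_fin mulrC mulrA.
apply: (@le_trans _ _ (\int[mu]_y (g \_ [set y | (sig rho)%:E < g y]) y)).
  apply: ge0_subset_integral => //; first exact: mball.
  - exact: superlevel_part_measurable.
  - by move=> y _; exact: superlevel_part_ge0.
apply: le_trans (integral_superlevel_le1 hPhi g0 mg s0 g1) _.
by rewrite sE powRN invrK mulrC.
Qed.

Let dyadic_weight (r : R) k : (0 < r)%R ->
  ((r / 2 ^+ k.+1) `^ (alpha - Q) * (r / 2 ^+ k) `^ Q =
   2 `^ (Q - alpha) * r `^ alpha * (2 `^ (- alpha)) ^+ k)%R.
Proof.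
move=> r0; have p2 : (0 < 2 ^+ k :> R)%R by rewrite exprn_gt0.
have rho0 : (0 < r / 2 ^+ k)%R by rewrite divr_gt0.
rewrite exprSr invfM mulrA (powR_div _ (ltW rho0))// mulrAC -powRD; last first.
  by rewrite (gt_eqF rho0) implybT.
rewrite subrK (powR_div _ (ltW r0))// powRXn// powRN exprVn.
rewrite -[in RHS](opprB alpha) powRN; ring.
Qed.

(** Sum of the geometric series of ratio 2^(- alpha) coming from [dyadic_weight]. *)
Let Dlow : R := (2 `^ (Q - alpha) / (1 - 2 `^ (- alpha)))%R.

Let q_lt1 : (0 < (2 : R) `^ (- alpha) < 1)%R.
Proof.
rewrite powR_gt0//= powRN invf_lt1 ?powR_gt0//.
have := @gt0_ltr_powR R alpha alpha_gt0 1%R 2%R.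
by rewrite !nnegrE powR1; apply => //; rewrite ltr1n.
Qed.

Let Dlow_ge0 : (0 <= Dlow)%R.
Proof. by have /andP[_ ?] := q_lt1; rewrite divr_ge0 ?powR_ge0// subr_ge0 ltW. Qed.

Let dyadic_series_le (c r : R) : (0 <= c)%R -> (0 < r)%R ->
  \sum_(k <oo) (c * ((r / 2 ^+ k.+1) `^ (alpha - Q) * (r / 2 ^+ k) `^ Q))%:E <=
  (c * Dlow * r `^ alpha)%:E.
Proof.
move=> c0 r0.
under eq_eseriesr => k _ do rewrite (dyadic_weight _ r0) mulrA.
apply: le_trans (nneseries_geometric_le _ q_lt1) _.
  by rewrite !mulr_ge0 ?powR_ge0.
by rewrite lee_fin le_eqVlt /Dlow; apply/orP; left; apply/eqP; ring.
Qed.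

(** The integral hypothesis enters here, through the dyadic comparison applied to [sig]. *)
Let dyadic_tail_le (r : R) : (0 < r)%R ->
  \sum_(k <oo) ((2 ^+ k * r) `^ alpha * sig (2 ^+ k.+1 * r))%:E <=
  (2 * A * r `^ alpha * sig r)%:E.
Proof.
move=> r0; apply: le_trans (dyadic_sum_le_integral (ltW alpha_gt0) r0 _ _) _.
- by move=> t /sigP[/ltW].
- exact: sig_anti.
have [_ _ sE] := sigP r0.
have := hint r0; rewrite sE => h.
rewrite -!mulrA EFinM lee_pmul2l// !EFinM; apply: le_trans h.
rewrite le_eqVlt; apply/orP; left; apply/eqP/eq_integral => t.
rewrite inE/= in_itv/= andbT => rt.
by have [_ _ ->] := sigP (lt_le_trans r0 rt).
Qed.

(** The summands belong to the near part below the level, to the L^1 norm of the near part above the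
    level, and to the far part. *)
Let D : R := (K3 * Dlow + K3 * (3 * K1 ^+ 2) `^ Q * Dlow +
  (K3 + 1) * 2 `^ Q * (2 * A))%R.

Let far_part_le g x (r : R) : (0 < r)%R ->
  (forall y, 0 <= g y) -> measurable_fun setT g ->
  \int[mu]_y young_ext Phi (g y) <= 1 ->
  \sum_(k <oo) ((2 ^+ k * r) `^ (alpha - Q))%:E *
     \int[mu]_(y in qball d x (2 ^+ k.+1 * r)) g y <=
  ((K3 + 1) * 2 `^ Q * (2 * A) * r `^ alpha * sig r)%:E.
Proof.
move=> r0 g0 mg g1.
have p2 k : (0 < 2 ^+ k * r)%R by rewrite mulr_gt0// exprn_gt0.
have C0 : (0 <= (K3 + 1) * 2 `^ Q)%R by rewrite mulr_ge0 ?powR_ge0 ?addr_ge0// ltW.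
apply: (@le_trans _ _ (((K3 + 1) * 2 `^ Q)%:E *
    \sum_(k <oo) ((2 ^+ k * r) `^ alpha * sig (2 ^+ k.+1 * r))%:E)); last first.
  rewrite (_ : (_ * sig r)%R =
      ((K3 + 1) * 2 `^ Q * (2 * A * r `^ alpha * sig r))%R); last by ring.
  rewrite [leRHS]EFinM; apply: lee_wpmul2l; first by rewrite lee_fin.
  exact: dyadic_tail_le.
rewrite -nneseriesZl; last first.
  by move=> k _; rewrite lee_fin mulr_ge0 ?powR_ge0//; have [/ltW] := sigP (p2 k.+1).
apply: lee_nneseries => k _.
  by rewrite mule_ge0 ?lee_fin ?powR_ge0// integral_ge0.
apply: (@le_trans _ _ (((2 ^+ k * r) `^ (alpha - Q))%:E *
  ((K3 + 1) * (2 ^+ k.+1 * r) `^ Q * sig (2 ^+ k.+1 * r))%:E)).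
  by apply: lee_wpmul2l; rewrite ?lee_fin ?powR_ge0//; exact: ball_integral_le.
rewrite -!EFinM lee_fin le_eqVlt; apply/orP; left; apply/eqP.
(* The ball has twice the radius at which the kernel is evaluated, which costs 2^Q. *)
have -> : ((2 ^+ k.+1 * r) `^ Q = 2 `^ Q * (2 ^+ k * r) `^ Q)%R.
  by rewrite -powRM ?(ltW (p2 k))// exprS mulrA.
have -> : ((2 ^+ k * r) `^ alpha = (2 ^+ k * r) `^ (alpha - Q) * (2 ^+ k * r) `^ Q)%R.
  by rewrite -powRD ?subrK// (gt_eqF (p2 k)) implybT.
ring.
Qed.

(* Only the superlevel part of [g] near the diagonal escapes a pointwise bound;
   as [L] it is controlled in L^1. *)
Lemma hedberg_split : exists2 C : R, (0 < C)%R &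
  forall (g : X -> \bar R) (s r : R), (0 < s)%R -> (0 < r)%R ->
  fine (Phi s) = (r `^ (- Q))%R ->
  (forall y, 0 <= g y) -> measurable_fun setT g ->
  \int[mu]_y young_ext Phi (g y) <= 1 ->
  exists L : X -> \bar R, [/\ forall x, 0 <= L x, measurable_fun setT L,
    forall x, I g x <= L x + (C * r `^ alpha * s)%:E &
    \int[mu]_x L x <=
      (C * r `^ alpha)%:E * \int[mu]_x (g \_ [set y | s%:E < g y]) x].
Proof.
have D1 : (0 <= K3 * Dlow)%R by rewrite mulr_ge0// ltW.
have D2 : (0 <= K3 * (3 * K1 ^+ 2) `^ Q * Dlow)%R.
  by rewrite mulr_ge0// mulr_ge0 ?powR_ge0// ltW.
have D3 : (0 < (K3 + 1) * 2 `^ Q * (2 * A))%R.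
  by rewrite !mulr_gt0 ?powR_gt0// addr_gt0.
exists D; first by rewrite ltr_wpDl// addr_ge0.
move=> g s r s0 r0 sr g0 mg g1.
have sigr : sig r = s by rewrite /sig -sr young_inv_fine// ltW.
(* An empty space is treated apart, because the cover by balls needs a first point. *)
have [[x0 _]|nX] := pselect (exists x0 : X, True); last first.
  exists (cst 0); split => //; first by move=> x; exfalso; apply: nX; exists x.
  by rewrite integral0 mule_ge0// ?lee_fin ?mulr_ge0 ?powR_ge0 ?addr_ge0// ?(ltW D3)//;
    apply: integral_ge0 => y _; exact: superlevel_part_ge0.
pose h := g \_ [set y | s%:E < g y].
have h0 y : 0 <= h y by exact: superlevel_part_ge0.
have mh : measurable_fun setT h by exact: superlevel_part_measurable.
have rk k : (0 < r / 2 ^+ k)%R by rewrite divr_gt0// exprn_gt0.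
(* [Ak k] is a measurable majorant of the integrals of the superlevel part over balls of radius r /
   2^k; [L] is the sum of these with the kernel weights [w k]. *)
have [Ak hAk] := choice (fun k => ball_integral_majorant d_sym K1_ge1
  d_triangle mball K3_ge1 ball_growth x0 (rk k) h0 mh).
pose w k : R := ((r / 2 ^+ k.+1) `^ (alpha - Q))%R.
have w0 k : (0 <= w k)%R by exact: powR_ge0.
have wA0 k x : 0 <= (w k)%:E * Ak k x.
  by rewrite mule_ge0 ?lee_fin//; have [+ _ _ _] := hAk k; exact.
have mwA k : measurable_fun setT (fun x => (w k)%:E * Ak k x).
  by apply: emeasurable_funM => //; have [_ + _ _] := hAk k; exact.
exists (fun x => \sum_(k <oo) (w k)%:E * Ak k x); split.
- by move=> x; apply: nneseries_ge0.
- exact: ge0_measurable_nneseries.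
- move=> x; apply: le_trans (fractional_integral_le_dyadic mu d_ge0 mball alphaQ x r0 g0 mg) _.
  (* Each near ball integral is cut at level [s]: the part below sums to a geometric series, the
     part above is absorbed by [Ak k]. *)
  have low : \sum_(k <oo) (w k)%:E * \int[mu]_(y in qball d x (r / 2 ^+ k)) g y <=
      \sum_(k <oo) (w k)%:E * Ak k x + (K3 * s * Dlow * r `^ alpha)%:E.
    have Ks : (0 <= K3 * s)%R by rewrite mulr_ge0// ltW.
    apply: (@le_trans _ _ (\sum_(k <oo) (w k)%:E * Ak k x +
      \sum_(k <oo) ((K3 * s) * ((r / 2 ^+ k.+1) `^ (alpha - Q) * (r / 2 ^+ k) `^ Q))%:E));
      last by rewrite leeD2l// dyadic_series_le.
    rewrite -nneseriesD//; last first.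
      by move=> k _ _; rewrite lee_fin !mulr_ge0 ?powR_ge0// ltW.
    apply: lee_nneseries => k _; first by rewrite mule_ge0 ?lee_fin// integral_ge0.
    apply: (@le_trans _ _ ((w k)%:E * (s%:E * (K3 * (r / 2 ^+ k) `^ Q)%:E + Ak k x))).
      apply: lee_wpmul2l; first by rewrite lee_fin.
      apply: le_trans (integral_le_level_split mu g0 mg s0 (mball x (rk k))) _.
      apply: leeD; first by rewrite lee_pmul2l//; case/andP: (ball_growth x (rk k)).
      by have [_ _ + _] := hAk k; exact.
    rewrite ge0_muleDr ?lee_fin//; last 2 first.
    - by rewrite !mulr_ge0 ?powR_ge0// ltW.
    - by have [+ _ _ _] := hAk k; exact.
    rewrite addeC; apply: leeD => //.
    by rewrite -!EFinM lee_fin /w le_eqVlt; apply/orP; left; apply/eqP; ring.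
  apply: le_trans (leeD low (far_part_le x r0 g0 mg g1)) _.
  rewrite -addeA; apply: leeD => //.
  rewrite -EFinD lee_fin sigr /D -subr_ge0.
  rewrite (_ : _ - _ = K3 * (3 * K1 ^+ 2) `^ Q * Dlow * (r `^ alpha * s))%R; last by ring.
  by apply: mulr_ge0 => //; rewrite mulr_ge0 ?powR_ge0// ltW.
(* The norm bound for [Ak k] carries a factor (r / 2^k)^Q, so the weights sum to the same geometric
   series as before. *)
- rewrite integral_nneseries//.
  have ih0 : 0 <= \int[mu]_x h x by apply: integral_ge0.
  have KK : (0 <= K3 * (3 * K1 ^+ 2) `^ Q)%R by rewrite mulr_ge0 ?powR_ge0// ltW.
  have DD : (K3 * (3 * K1 ^+ 2) `^ Q * Dlow * r `^ alpha <= D * r `^ alpha)%R.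
    rewrite ler_wpM2r ?powR_ge0// /D -subr_ge0.
    by rewrite (_ : _ - _ = K3 * Dlow + (K3 + 1) * 2 `^ Q * (2 * A))%R; [rewrite addr_ge0// ltW|ring].
  apply: (@le_trans _ _ ((K3 * (3 * K1 ^+ 2) `^ Q * Dlow * r `^ alpha)%:E *
      \int[mu]_x h x)); last first.
    by apply: lee_wpmul2r.
  apply: (@le_trans _ _ ((\sum_(k <oo) (K3 * (3 * K1 ^+ 2) `^ Q *
     ((r / 2 ^+ k.+1) `^ (alpha - Q) * (r / 2 ^+ k) `^ Q))%:E) * \int[mu]_x h x));
    last by apply: lee_wpmul2r => //; exact: dyadic_series_le.
  apply: nneseries_le_bound => [k|n]; first exact: integral_ge0.
  apply: (@le_trans _ _ ((\sum_(0 <= k < n) (K3 * (3 * K1 ^+ 2) `^ Q *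
     ((r / 2 ^+ k.+1) `^ (alpha - Q) * (r / 2 ^+ k) `^ Q))%:E) * \int[mu]_x h x)); last first.
    apply: lee_wpmul2r => //; apply: nneseries_lim_ge => k _ _.
    by rewrite lee_fin mulr_ge0// mulr_ge0 ?powR_ge0.
  rewrite ge0_sume_distrl; last first.
    by move=> k _; rewrite lee_fin mulr_ge0// mulr_ge0 ?powR_ge0.
  apply: lee_sum => k _; have [Ak0 mAk _ Akle] := hAk k.
  rewrite ge0_integralZl_EFin//.
  apply: (@le_trans _ _ ((w k)%:E * ((K3 * (3 * K1 ^+ 2 * (r / 2 ^+ k)) `^ Q)%:E * \int[mu]_x h x))).
    by apply: lee_wpmul2l => //; rewrite lee_fin.
  rewrite muleA -EFinM; apply: lee_wpmul2r => //.
  rewrite lee_fin (powRM _ _ (ltW (rk k))); last by rewrite mulr_ge0// exprn_ge0// (le_trans ler01).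
  by rewrite /w le_eqVlt; apply/orP; left; apply/eqP; ring.
Qed.

End hedberg.

(** * Summation over levels *)

Section layered.
Context {R : realType} {disp : measure_display} {T : measurableType disp}.
Variables (mu : {measure set T -> \bar R}) (Phi : R -> \bar R) (k : R).
Hypothesis hPhi : young_Y Phi.
Hypothesis k_gt1 : (1 < k)%R.
Hypothesis Phi_nabla2 : forall r : R, (0 <= r)%R ->
  Phi r <= (2 * k)^-1%:E * Phi (k * r)%R.
Let phi r := fine (Phi r).
Let k_gt0 : (0 < k)%R. Proof. exact: lt_trans ltr01 k_gt1. Qed.
(** The weight that converts a bound on s mu(E) into one on Phi(k s) mu(E). *)
Let p (s : R) := (phi (k * s) / s)%R.

Let p_ge0 s : (0 < s)%R -> (0 <= p s)%R.
Proof. by move=> s0; rewrite divr_ge0 ?young_fine_ge0 ?mulr_ge0 ?ltW. Qed.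

(** The nabla_2 inequality at [k * s], divided by [s]. *)
Let p_halving s : (0 < s)%R -> (p s <= p (k * s) / 2)%R.
Proof.
move=> s0; have ks0 : (0 < k * s)%R by rewrite mulr_gt0.
have kks0 : (0 < k * (k * s))%R by rewrite mulr_gt0.
have := Phi_nabla2 (ltW ks0).
rewrite (youngE hPhi (ltW ks0)) (youngE hPhi (ltW kks0)) -EFinM lee_fin => h.
rewrite /p ler_pdivrMr// (le_trans h)// le_eqVlt; apply/orP; left; apply/eqP.
by rewrite /phi; field; rewrite !gt_eqF.
Qed.

Let p_le_ratio s y : (0 < s)%R -> (k * s <= y)%R -> (p s <= k * (phi y / y))%R.
Proof.
move=> s0 ksy; have ks0 : (0 < k * s)%R by rewrite mulr_gt0.
apply: le_trans (_ : k * (phi (k * s) / (k * s)) <= _)%R; last first.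
  by rewrite ler_pM2l// young_fine_ratio_le.
by rewrite /p le_eqVlt; apply/orP; left; apply/eqP; field; rewrite !gt_eqF.
Qed.

(** After exchanging sum and integral, only levels below c = g y count at [y]. Their weights are at
    most k Phi(4 k c) / (4 k c), so they add up to at most twice this; multiplied by c, this is
    Phi(4 k c) / 2. The hypothesis on partial sums covers increasing and decreasing levels alike. *)
Let layer_series_le (g : T -> \bar R) (s : nat -> R) (E : nat -> set T) :
  (forall y, 0 <= g y) -> measurable_fun setT g ->
  (forall n, (0 < s n)%R) ->
  (forall (P : pred nat) (B : R) n, (0 <= B)%R ->
    (forall i, P i -> p (s i) <= B)%R ->
    (\sum_(i < n | P i) p (s i) <= 2 * B)%R) ->
  (forall n, (s n)%:E * mu (E n) <= \int[mu]_y (g \_ [set y | (s n)%:E < g y]) y) ->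
  \int[mu]_y young_ext Phi ((4 * k)%:E * g y) <= 1 ->
  \sum_(n <oo) (phi (k * s n))%:E * mu (E n) <= 2^-1%:E.
Proof.
move=> g0 mg s0 sB sE g1.
pose h n := g \_ [set y | (s n)%:E < g y].
have h0 n y : 0 <= h n y by exact: superlevel_part_ge0.
have mh n : measurable_fun setT (h n) by exact: superlevel_part_measurable.
have ps n : 0 <= (p (s n))%:E by rewrite lee_fin p_ge0.
apply: (@le_trans _ _ (\int[mu]_y \sum_(n <oo) (p (s n))%:E * h n y)).
  rewrite integral_nneseries//; last 2 first.
  - by move=> n; apply: emeasurable_funM.
  - by move=> n y _; rewrite mule_ge0.
  apply: lee_nneseries => n _.
    by rewrite mule_ge0// lee_fin young_fine_ge0// mulr_ge0 ?ltW.
  rewrite ge0_integralZl_EFin// -?lee_fin//.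
  apply: le_trans (_ : (p (s n))%:E * ((s n)%:E * mu (E n)) <= _).
    by rewrite muleA -EFinM /p divfK// gt_eqF.
  exact: lee_wpmul2l.
have mF : measurable_fun setT (fun y => (4 * k)%:E * g y) by apply: emeasurable_funM.
have k4 : (0 < 4 * k)%R by rewrite mulr_gt0.
have F0 y : 0 <= (4 * k)%:E * g y by rewrite mule_ge0// lee_fin ltW.
apply: (@le_trans _ _ (\int[mu]_y (2^-1%:E * young_ext Phi ((4 * k)%:E * g y)))); last first.
  rewrite ge0_integralZl_EFin//; last 2 first.
  - by move=> y _; exact: (young_ext_ge0 hPhi).
  - exact: (young_ext_measurable hPhi).
  rewrite -[leRHS]mule1; apply: lee_wpmul2l => //.
apply: ge0_le_lower_integral => y _.
  by apply: nneseries_ge0 => n _ _; rewrite mule_ge0.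
apply: nneseries_le_bound => [n|n]; first by rewrite mule_ge0.
have := g0 y; case gE : (g y) => [c| |]// c0; last first.
  by rewrite gt0_muley ?lte_fin//= gt0_muley ?leey// lte_fin invr_gt0.
rewrite lee_fin in c0.
have -> : \sum_(0 <= i < n) (p (s i))%:E * h i y =
    (\sum_(i < n | (s i < c)%R) p (s i) * c)%:E.
  rewrite -sumEFin [RHS]big_mkcond/= big_mkord; apply: eq_bigr => i _.
  rewrite /h patchE gE/=.
  rewrite (_ : (y \in _) = (s i < c)%R).
    by case: ifP; rewrite ?mule0.
  by apply/idP/idP; rewrite inE/= gE lte_fin.
move: c0; rewrite le_eqVlt => /predU1P[c0|c0].
  rewrite big1 ?mule_ge0 ?lee_fin ?invr_ge0 ?young_ext_ge0//.
    by rewrite mule_ge0// lee_fin -?c0 // ltW.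
  by move=> i; rewrite -c0 ltNge (ltW (s0 i)).
have kc0 : (0 < 4 * k * c)%R by rewrite mulr_gt0.
rewrite /= (youngE hPhi (ltW kc0)) -EFinM lee_fin -mulr_suml.
have B0 : (0 <= k * (phi (4 * k * c) / (4 * k * c)))%R.
  by rewrite mulr_ge0 ?(ltW k_gt0)// divr_ge0 ?young_fine_ge0// ltW.
apply: le_trans (_ : 2 * (k * (phi (4 * k * c) / (4 * k * c))) * c <= _)%R.
  rewrite ler_pM2r//; apply: (sB (fun i => s i < c)%R) => // i sc; apply: p_le_ratio => //.
  rewrite (_ : 4 * k * c = k * (4 * c))%R; last by ring.
  by rewrite ler_pM2l//; move: (s0 i); lra.
rewrite le_eqVlt; apply/orP; left; apply/eqP; rewrite -/(phi _).
by field; rewrite !gt_eqF.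
Qed.

(* The levels are the integer powers of the nabla_2 constant [k], which makes
   the weights [Phi (k s) / s] at the levels [s] below a given one geometric. *)
Lemma layered_integral_le1 (V g : T -> \bar R) :
  (forall x, 0 <= V x) -> (forall y, 0 <= g y) -> measurable_fun setT g ->
  (forall s : R, (0 < s)%R -> exists E, [/\ measurable E,
     s%:E * mu E <= \int[mu]_y (g \_ [set y | s%:E < g y]) y &
     forall x, ~ E x -> V x <= (fine (Phi s))%:E]) ->
  \int[mu]_y young_ext Phi ((4 * k)%:E * g y) <= 1 ->
  \int[mu]_x V x <= 1.
Proof.
move=> V0 g0 mg hE g1.
have kn n : (0 < k ^+ n)%R by rewrite exprn_gt0.
(* [u] runs through k^0, k^1, ... and [v] through k^-1, k^-2, ...; the shift in [v] keeps the level
   1 from occurring twice. *)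
pose u n : R := (k ^+ n)%R; pose v n : R := ((k ^+ n.+1)^-1)%R.
have u0 n : (0 < u n)%R by [].
have v0 n : (0 < v n)%R by rewrite invr_gt0.
have kv n : (k * v n.+1 = v n)%R.
  by rewrite /v (exprS _ n.+1) invfM mulVKf// gt_eqF.
have [E hEu] := choice (fun n => hE _ (u0 n)).
have [G hGv] := choice (fun n => hE _ (v0 n)).
pose Su x := \sum_(n <oo) (phi (k * u n))%:E * (\1_(E n) x)%:E.
pose Sv x := \sum_(n <oo) (phi (k * v n))%:E * (\1_(G n) x)%:E.
have ph0 t : (0 < t)%R -> 0 <= (phi (k * t))%:E.
  by move=> t0; rewrite lee_fin young_fine_ge0// mulr_ge0 ?ltW.
have tu0 n x : 0 <= (phi (k * u n))%:E * (\1_(E n) x)%:E.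
  by rewrite mule_ge0 ?ph0// lee_fin.
have tv0 n x : 0 <= (phi (k * v n))%:E * (\1_(G n) x)%:E.
  by rewrite mule_ge0 ?ph0// lee_fin.
have mtu n : measurable_fun setT (fun x => (phi (k * u n))%:E * (\1_(E n) x)%:E).
  apply: emeasurable_funM => //; apply/measurable_EFinP.
  by have [+ _ _] := hEu n; exact: measurable_indic.
have mtv n : measurable_fun setT (fun x => (phi (k * v n))%:E * (\1_(G n) x)%:E).
  apply: emeasurable_funM => //; apply/measurable_EFinP.
  by have [+ _ _] := hGv n; exact: measurable_indic.
have V_le x : V x <= Su x + Sv x.
  have Su0 : 0 <= Su x by apply: nneseries_ge0.
  have Sv0 : 0 <= Sv x by apply: nneseries_ge0.
  have inE_ n : (phi (u n))%:E < V x -> x \in E n.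
    move=> Vx; rewrite inE; apply: contrapT => nE.
    by have [_ _ /(_ x nE)] := hEu n; rewrite leNgt Vx.
  have inG_ n : (phi (v n))%:E < V x -> x \in G n.
    move=> Vx; rewrite inE; apply: contrapT => nE.
    by have [_ _ /(_ x nE)] := hGv n; rewrite leNgt Vx.
  (* An infinite value puts [x] in every [E n], and the terms Phi(k^(n+1)) of the series are
     unbounded. *)
  have := V0 x; case VE : (V x) => [c| |]// c0; last first.
    rewrite (_ : Su x = +oo) ?addye ?leey//; first by rewrite gt_eqF// (lt_le_trans _ Sv0).
    apply: nneseries_unbounded => // M.
    have p1 : (0 < phi 1)%R by exact: young_fine_gt0.
    have [n Mn] := exists_lt_expr (M / phi 1) k_gt1.
    exists n; rewrite indicE inE_ ?VE ?ltry// mule1 lee_fin.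
    have k1n : (1 <= k * u n)%R by rewrite /u -exprS exprn_ege1// ltW.
    have := young_fine_ratio_le hPhi ltr01 k1n.
    rewrite divr1 ler_pdivlMr ?(lt_le_trans ltr01)// -/(phi _) -/(phi _).
    apply: le_trans; rewrite mulrC -ler_pdivrMr// (le_trans (ltW Mn))//.
    by rewrite /u ler_peMl ?ltW.
  move: c0; rewrite lee_fin le_eqVlt => /predU1P[<-|c0]; first by rewrite adde_ge0.
  (* [Phi] takes the value [V x] at [sg]. For the level s with s < sg <= k s, the point lies in the
     exceptional set of s, and the term Phi(k s) of that set dominates [V x]. *)
  have [sg [sg0 sgc _]] := young_inv_spec hPhi c0.
  have [sg1|sg1] := ltP 1%R sg.
    have [n /andP[ns sn]] := exists_expr_bracket_lt k_gt1 sg1.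
    apply: le_trans (leeDl _ Sv0); apply: le_trans (nneseries_ge_term n _) => //.
    rewrite indicE inE_; last by rewrite VE lte_fin -sgc young_fine_lt// ltW.
    by rewrite mule1 lee_fin -sgc young_fine_le ?(ltW sg0)// /u -exprS.
  have sgV : (1 <= sg^-1)%R by rewrite invf_ge1.
  have [n /andP[ns sn]] := exists_expr_bracket k_gt1 sgV.
  apply: le_trans (leeDr _ Su0); apply: le_trans (nneseries_ge_term n _) => //.
  rewrite indicE inG_; last first.
    rewrite VE lte_fin -sgc young_fine_lt ?(ltW (v0 n))//.
    by rewrite /v -[ltRHS]invrK ltf_pV2 ?posrE ?invr_gt0.
  rewrite mule1 lee_fin -sgc young_fine_le ?(ltW sg0)//.
  rewrite /v exprS invfM mulrA divff ?gt_eqF// mul1r.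
  by rewrite -[leLHS]invrK lef_pV2 ?posrE ?invr_gt0.
apply: (@le_trans _ _ (\int[mu]_x (Su x + Sv x))).
  exact: ge0_le_lower_integral.
rewrite ge0_integralD//; last 4 first.
- by move=> x _; apply: nneseries_ge0.
- exact: ge0_measurable_nneseries.
- by move=> x _; apply: nneseries_ge0.
- exact: ge0_measurable_nneseries.
(* Half of the bound goes to the levels from 1 on, half to those below 1. *)
have -> : 1 = 2^-1%:E + 2^-1%:E :> \bar R by rewrite -EFinD; congr EFin; field.
apply: leeD; rewrite integral_nneseries//.
- have -> : \sum_(n <oo) \int[mu]_x ((phi (k * u n))%:E * (\1_(E n) x)%:E) =
      \sum_(n <oo) (phi (k * u n))%:E * mu (E n).
    apply: eq_eseriesr => n _; have [mE _ _] := hEu n.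
    rewrite ge0_integralZl_EFin//; last 2 first.
    + by apply/measurable_EFinP; exact: measurable_indic.
    + by rewrite -lee_fin ph0.
    by rewrite integral_indic// setIT.
  apply: layer_series_le g1 => //; last by move=> n; have [] := hEu n.
  move=> P B n B0 PB; apply: (@sum_doubling_le _ (fun i => p (u i))) => // i; first exact: p_ge0.
  by apply: le_trans (p_halving (u0 i)) _; rewrite /u exprS.
- have -> : \sum_(n <oo) \int[mu]_x ((phi (k * v n))%:E * (\1_(G n) x)%:E) =
      \sum_(n <oo) (phi (k * v n))%:E * mu (G n).
    apply: eq_eseriesr => n _; have [mE _ _] := hGv n.
    rewrite ge0_integralZl_EFin//; last 2 first.
    + by apply/measurable_EFinP; exact: measurable_indic.
    + by rewrite -lee_fin ph0.
    by rewrite integral_indic// setIT.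
  apply: layer_series_le g1 => //; last by move=> n; have [] := hGv n.
  move=> P B n B0 PB; apply: (@sum_halving_le _ (fun i => p (v i))) => // i; first exact: p_ge0.
  by apply: le_trans (p_halving (v0 i.+1)) _; rewrite kv.
Qed.

End layered.

(** * Sufficiency *)

Section admissible_scalings.
Context {R : realType} {disp : measure_display} {X : topMeasurableType disp}.
Variables (d : X -> X -> R) (mu : {measure set X -> \bar R}).
Implicit Types (f : X -> \bar R) (Phi : R -> \bar R).

Lemma ediv_EFin (x : \bar R) (l : R) : (0 < l)%R -> x / l%:E = l^-1%:E * x.
Proof. by move=> l0; rewrite inver gt_eqF// muleC. Qed.

Lemma abse_scale_measurable f (c : R) : measurable_fun setT f ->
  measurable_fun setT (fun y => c%:E * `|f y|).
Proof. by move=> mf; apply: emeasurable_funM => //; exact: measurableT_comp. Qed.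

Lemma ereal_inf_le_scale (c : R) (S S' : set R) : (0 < c)%R ->
  (forall l, S l -> S' (c * l)%R) ->
  ereal_inf [set l%:E | l in S'] <= c%:E * ereal_inf [set l%:E | l in S].
Proof.
move=> c0 SS'; rewrite -lee_pdivrMl//; apply: le_ereal_inf_tmp => _ [l Sl <-].
rewrite lee_pdivrMl//; apply: ereal_inf_lbound; exists (c * l)%R => //.
exact: SS'.
Qed.

(** By convexity, dividing the argument of [Phi] by N >= 1 divides the integral by at least N. The
    choice N = max(1, J), with J the finite integral given by membership, brings it down to 1. *)
Lemma orlicz_admissible Phi f : young_Y Phi -> orlicz d mu Phi f ->
  exists2 l : R, (0 < l)%R & \int[mu]_x young_ext Phi (`|f x| / l%:E) <= 1.
Proof.
move=> hPhi [[mf _] [e e0 fin]].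
have ef0 x : 0 <= e%:E * `|f x| by rewrite mule_ge0// lee_fin ltW.
pose J := \int[mu]_x young_ext Phi (e%:E * `|f x|).
have J0 : 0 <= J by apply: integral_ge0 => x _; exact: (young_ext_ge0 hPhi).
have JE : J = (fine J)%:E by rewrite fineK// ge0_fin_numE.
pose N : R := Num.max 1%R (fine J).
have N1 : (1 <= N)%R by rewrite le_max lexx.
have N0 : (0 < N)%R by rewrite (lt_le_trans ltr01).
exists (N / e)%R; first by rewrite divr_gt0.
apply: (@le_trans _ _ (\int[mu]_x (N^-1%:E * young_ext Phi (e%:E * `|f x|)))).
  apply: ge0_le_lower_integral => x _.
    by rewrite (young_ext_ge0 hPhi)// mule_ge0// inve_ge0 lee_fin divr_ge0// ltW.
  rewrite ediv_EFin ?divr_gt0// invf_div mulrC EFinM -muleA.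
  exact: young_ext_scale_le.
rewrite ge0_integralZl_EFin//; last 3 first.
- by move=> x _; exact: (young_ext_ge0 hPhi).
- apply: (young_ext_measurable hPhi) => //.
  exact: abse_scale_measurable.
- by rewrite invr_ge0 ltW.
by rewrite -/J JE -EFinM lee_fin mulrC ler_pdivrMr// mul1r le_max lexx orbT.
Qed.

Lemma orlicz_normP Phi Psi (T : (X -> \bar R) -> X -> \bar R) (c : R) f :
  (0 < c)%R ->
  (forall l, (0 < l)%R -> \int[mu]_x young_ext Phi (`|f x| / l%:E) <= 1 ->
     \int[mu]_x young_ext Psi (`|T f x| / (c * l)%:E) <= 1) ->
  orlicz_norm mu Psi (T f) <= c%:E * orlicz_norm mu Phi f.
Proof.
move=> c0 h; apply: ereal_inf_le_scale => // l [l0 hl].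
by split; [rewrite mulr_gt0|exact: h].
Qed.

Lemma weak_orlicz_normP Phi Psi (T : (X -> \bar R) -> X -> \bar R) (c : R) f :
  (0 < c)%R ->
  (forall l, (0 < l)%R -> \int[mu]_x young_ext Phi (`|f x| / l%:E) <= 1 ->
     forall t, (0 < t)%R -> Psi (t / (c * l))%R * distribution_fun mu (T f) t <= 1) ->
  weak_orlicz_norm mu Psi (T f) <= c%:E * orlicz_norm mu Phi f.
Proof.
move=> c0 h; apply: ereal_inf_le_scale => // l [l0 hl].
split; first by rewrite mulr_gt0.
by apply: ge_ereal_sup => _ [t t0 <-]; exact: h.
Qed.

End admissible_scalings.

Section sufficiency.
Context {R : realType} {disp : measure_display} {X : topMeasurableType disp}.
Variables (d : X -> X -> R) (mu : {measure set X -> \bar R}) (Q K1 K3 : R).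
Hypothesis d_ge0 : forall x y, (0 <= d x y)%R.
Hypothesis d_sym : forall x y, d x y = d y x.
Hypothesis K1_ge1 : (1 <= K1)%R.
Hypothesis d_triangle : forall x y z, (d x y <= K1 * (d x z + d z y))%R.
Hypothesis mball : forall x r, (0 < r)%R -> measurable (qball d x r).
Hypothesis K3_ge1 : (1 <= K3)%R.
Hypothesis ball_growth : forall x r, (0 < r)%R ->
  (K3^-1 * r `^ Q)%:E <= mu (qball d x r) <= (K3 * r `^ Q)%:E.
Variables (alpha A : R) (Phi Psi : R -> \bar R).
Hypotheses (Q_gt0 : (0 < Q)%R) (alpha_gt0 : (0 < alpha)%R) (alphaQ : (alpha < Q)%R).
Hypotheses (hPhi : young_Y Phi) (hPsi : young_Y Psi).
Hypotheses (A_gt0 : (0 < A)%R) (hint : forall r : R, (0 < r)%R ->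
       \int[lebesgue_measure]_(t in `[r, +oo[)
          ((t `^ (alpha - 1))%:E * young_inv Phi (t `^ (- Q)))
       <= A%:E * ((r `^ alpha)%:E * young_inv Phi (r `^ (- Q)))).
Hypothesis star : star_condition Q alpha Phi Psi.
Notation I := (fractional_integral d mu Q alpha).

Let hedberg := hedberg_split d_ge0 d_sym K1_ge1 d_triangle mball K3_ge1
  ball_growth Q_gt0 alpha_gt0 alphaQ hPhi A_gt0 hint.

Lemma level_radius s : (0 < s)%R ->
  exists2 r : R, (0 < r)%R & fine (Phi s) = (r `^ (- Q))%R.
Proof.
move=> s0; have p0 := young_fine_gt0 hPhi s0.
by exists (fine (Phi s) `^ (- Q^-1))%R; rewrite ?powR_gt0// powRNK.
Qed.

(** With Phi(s) = Psi(tau) = r^-Q, condition (star) reads r^alpha s <= A' tau. The set [E] is where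
    [L] is at least C r^alpha s, and in Markov's inequality the factor C r^alpha cancels. *)
Lemma fractional_integral_level : exists2 C : R, (0 < C)%R &
  forall (g : X -> \bar R) (s tau : R), (0 < s)%R -> (0 < tau)%R ->
  fine (Phi s) = fine (Psi tau) ->
  (forall y, 0 <= g y) -> measurable_fun setT g ->
  \int[mu]_y young_ext Phi (g y) <= 1 ->
  exists E, [/\ measurable E,
    s%:E * mu E <= \int[mu]_y (g \_ [set y | s%:E < g y]) y &
    forall x, ~ E x -> I g x <= (C * tau)%:E].
Proof.
have [C C0 hC] := hedberg; have [A' A'0 hA'] := star.
(* Outside [E], both [L] and the pointwise remainder are at most C r^alpha s; hence the factor 2. *)
exists (2 * C * A')%R; first by rewrite !mulr_gt0.
move=> g s tau s0 tau0 st g0 mg g1.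
have [r r0 sr] := level_radius s0.
have [L [L0 mL IL iL]] := hC g s r s0 r0 sr g0 mg g1.
have ra0 : (0 < r `^ alpha)%R by rewrite powR_gt0.
have Cr0 : (0 < C * r `^ alpha)%R by rewrite mulr_gt0.
exists [set x | (C * r `^ alpha * s)%:E <= L x]; split.
- by rewrite -[X in measurable X]setTI; exact: emeasurable_fun_c_infty.
- have := lower_markov mu (A := [set x | (C * r `^ alpha * s)%:E <= L x]) _ _ L0 _.
  move=> /(_ (C * r `^ alpha * s)%R) h.
  have {}h := le_trans (h _ _ (fun x => id)) iL.
  rewrite -(@lee_pmul2l _ (C * r `^ alpha)%:E)// muleA -EFinM; apply: h.
    by rewrite -[X in measurable X]setTI; exact: emeasurable_fun_c_infty.
  by rewrite mulr_ge0// ltW.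
- move=> x /= /negP; rewrite -ltNge => Lx.
  apply: le_trans (IL x) _.
  apply: (@le_trans _ _ ((C * r `^ alpha * s)%:E + (C * r `^ alpha * s)%:E)).
    by apply: leeD => //; exact: ltW.
  rewrite -EFinD lee_fin.
  have := hA' r r0; rewrite -sr young_inv_fine ?(ltW s0)//.
  rewrite st young_inv_fine ?(ltW tau0)// -!EFinM lee_fin => h.
  have := ler_wpM2l (ltW C0) h; lra.
Qed.

Let scaled_ge0 (f : X -> \bar R) (c : R) y : (0 <= c)%R -> 0 <= c%:E * `|f y| :> \bar R.
Proof. by move=> c0; rewrite mule_ge0. Qed.

Let abse_I_le f (l : R) x : (0 < l)%R -> measurable_fun setT f ->
  `|I f x| <= l%:E * I (fun y => l^-1%:E * `|f y|) x.
Proof.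
move=> l0 mf; apply: le_trans (abse_fractional_integral_le mu d_ge0 mball alphaQ x mf) _.
rewrite (fractional_integralZl mu d_ge0 mball alphaQ)//; last 2 first.
- by rewrite invr_ge0 ltW.
- exact: measurableT_comp.
by rewrite muleA -EFinM divff ?gt_eqF// mul1e.
Qed.

Let admissibleE f (l : R) : (0 < l)%R ->
  \int[mu]_x young_ext Phi (`|f x| / l%:E) =
  \int[mu]_x young_ext Phi (l^-1%:E * `|f x|).
Proof. by move=> l0; apply: eq_integral => x _; rewrite ediv_EFin. Qed.

(** The splitting at the arbitrary level 1 bounds |I f| by a multiple of an integrable function plus
    a constant, and balls have finite measure. *)
Lemma fractional_integral_L1loc f : measurable_fun setT f ->
  (exists2 l : R, (0 < l)%R & \int[mu]_x young_ext Phi (`|f x| / l%:E) <= 1) ->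
  measurable_fun setT (I f) -> L1loc d mu (I f).
Proof.
move=> mf [l l0]; rewrite admissibleE// => fl mIf; split=> // x rho rho0.
apply/integrableP; split; first exact: measurable_funTS.
have [C C0 hC] := hedberg; have [r r0 sr] := level_radius ltr01.
have mg := abse_scale_measurable (l^-1)%R mf.
have li0 : (0 <= l^-1)%R by rewrite invr_ge0 ltW.
have g0 y := scaled_ge0 f y li0.
have [L [L0 mL IL iL]] := hC _ _ _ ltr01 r0 sr g0 mg fl.
set K := (C * r `^ alpha * 1)%R in IL.
have K0 : (0 <= K)%R by rewrite !mulr_ge0 ?powR_ge0// ltW.
have mB := mball x rho0.
apply: (@le_lt_trans _ _ (\int[mu]_(y in qball d x rho) (l%:E * (L y + K%:E)))).
  apply: ge0_le_lower_integral => y _ //.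
  apply: le_trans (abse_I_le y l0 mf) _.
  by apply: lee_wpmul2l => //; rewrite lee_fin ltW.
have mLK : measurable_fun (qball d x rho) (fun y => L y + K%:E).
  by apply: emeasurable_funD => //; exact: measurable_funTS.
rewrite ge0_integralZl_EFin//; last 2 first.
- by move=> y _; rewrite adde_ge0.
- exact: ltW.
rewrite lte_mul_pinfty ?lee_fin ?(ltW l0)//.
rewrite ge0_integralD//; last exact: measurable_funTS.
rewrite integral_cst//; apply: lte_add_pinfty; last first.
  rewrite lte_mul_pinfty ?lee_fin// (le_lt_trans _ (ltry (K3 * rho `^ Q)))//.
  by case/andP: (ball_growth x rho0).
apply: (@le_lt_trans _ _ (\int[mu]_y L y)).
  exact: ge0_subset_integral.
apply: le_lt_trans iL _; rewrite lte_mul_pinfty ?lee_fin//.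
  by rewrite mulr_ge0 ?powR_ge0// ltW.
apply: le_lt_trans (integral_superlevel_le1 hPhi g0 mg ltr01 fl) _.
exact: ltry.
Qed.

Lemma star_weak_bounded :
  bounded_operator (orlicz d mu Phi) (weak_orlicz d mu Psi)
       (orlicz_norm mu Phi) (weak_orlicz_norm mu Psi) I.
Proof.
have [C C0 hC] := fractional_integral_level.
have weak f (l t : R) : measurable_fun setT f -> (0 < l)%R -> (0 < t)%R ->
    \int[mu]_x young_ext Phi (`|f x| / l%:E) <= 1 ->
    Psi (t / (C * l))%R * distribution_fun mu (I f) t <= 1.
  move=> mf l0 t0; rewrite admissibleE// => fl.
  have mg := abse_scale_measurable (l^-1)%R mf.
  have li0 : (0 <= l^-1)%R by rewrite invr_ge0 ltW.
  have g0 y := scaled_ge0 f y li0.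
  (* Chosen so that the bound l (C tau) on |I f| outside [E] equals [t]. *)
  set tau := (t / (C * l))%R.
  have tau0 : (0 < tau)%R by rewrite divr_gt0// mulr_gt0.
  have [s [s0 sE _]] := young_inv_spec hPhi (young_fine_gt0 hPsi tau0).
  have [E [mE muE hE]] := hC _ _ _ s0 tau0 sE g0 mg fl.
  have tE : [set x | t%:E < `|I f x|] `<=` E.
    move=> x /= tx; apply: contrapT => /hE Ix; move: tx; apply/negP; rewrite -leNgt.
    apply: le_trans (abse_I_le x l0 mf) _.
    apply: (@le_trans _ _ (l%:E * (C * tau)%:E)).
      by apply: lee_wpmul2l => //; rewrite lee_fin ltW.
    rewrite -EFinM lee_fin le_eqVlt; apply/orP; left; apply/eqP.
    by rewrite /tau; field; rewrite !gt_eqF.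
  rewrite (youngE hPsi (ltW tau0)) -sE.
  (* The superlevel set of [I f] is not known to be measurable, but its outer measure is at most the
     measure of [E]. *)
  apply: (@le_trans _ _ ((fine (Phi s))%:E * mu E)).
    apply: lee_wpmul2l; first by rewrite lee_fin young_fine_ge0// ltW.
    by rewrite -(measurable_mu_extE mu mE); exact: le_mu_ext.
  apply: (@le_trans _ _ ((fine (Phi s) / s)%:E * (s%:E * mu E))).
    by rewrite muleA -EFinM divfK// gt_eqF.
  apply: le_trans fl; apply: le_trans (integral_superlevel_le mu hPhi g0 mg s0).
  by apply: lee_wpmul2l => //; rewrite lee_fin divr_ge0 ?young_fine_ge0 ?(ltW s0).
exists C => // f fPhi; have [[mf _] _] := fPhi; split; last first.
  by apply: weak_orlicz_normP => // l l0 fl t t0; exact: weak.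
have [l l0 fl] := orlicz_admissible hPhi fPhi.
move=> mIf; split; first by apply: fractional_integral_L1loc => //; exists l.
have Cl0 : (0 < C * l)%R by rewrite mulr_gt0.
exists ((C * l)^-1)%R; first by rewrite invr_gt0.
apply: (@le_lt_trans _ _ 1); last exact: ltry.
apply: ge_ereal_sup => _ [r r0 <-].
(* The factor [(C * l)^-1] on [I f] moves the level [r] to [r * (C * l)]. *)
have := weak f l (r * (C * l))%R mf l0 (mulr_gt0 r0 Cl0) fl.
rewrite mulfK ?gt_eqF//; congr (_ <= _); congr *%E; congr mu_ext.
have iC : `|((C * l)^-1)%:E| = ((C * l)^-1)%:E :> \bar R.
  by rewrite gee0_abs// lee_fin invr_ge0 ltW.
by apply/seteqP; split => x /=; rewrite abseM iC lte_pdivlMl// -EFinM mulrC.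
Qed.

Lemma star_strong_bounded : nabla2 Phi ->
  bounded_operator (orlicz d mu Phi) (orlicz d mu Psi)
       (orlicz_norm mu Phi) (orlicz_norm mu Psi) I.
Proof.
move=> [k k1 hk]; have [C C0 hC] := fractional_integral_level.
have k0 : (0 < k)%R := lt_trans ltr01 k1.
have N1 : (1 <= 4 * k)%R by lra.
have N0 : (0 < 4 * k)%R by lra.
pose c := (C * (4 * k))%R; have c0 : (0 < c)%R by rewrite mulr_gt0.
have strong f (l : R) : measurable_fun setT f -> (0 < l)%R ->
    \int[mu]_x young_ext Phi (`|f x| / l%:E) <= 1 ->
    \int[mu]_x young_ext Psi (`|I f x| / (c * l)%:E) <= 1.
  move=> mf l0; rewrite admissibleE// => fl.
  have l40 : (0 < 4 * k * l)%R by rewrite mulr_gt0.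
  have li0 : (0 <= (4 * k * l)^-1)%R by rewrite invr_ge0 ltW.
  (* Shrunk by the extra factor 4 k that the summation over levels requires; [gF] recovers the
     admissible function. *)
  pose g y := ((4 * k * l)^-1)%:E * `|f y|.
  have mg : measurable_fun setT g by exact: abse_scale_measurable.
  have g0 y : 0 <= g y := scaled_ge0 f y li0.
  have gF y : (4 * k)%:E * g y = l^-1%:E * `|f y|.
    rewrite /g muleA -EFinM; congr (_%:E * _); by field; rewrite !gt_eqF.
  have gl : \int[mu]_y young_ext Phi ((4 * k)%:E * g y) <= 1.
    by under eq_integral do rewrite gF.
  have g1 : \int[mu]_y young_ext Phi (g y) <= 1.
    apply: le_trans gl; apply: ge0_le_lower_integral => y _.
      exact: (young_ext_ge0 hPhi).
    by apply: (young_ext_le hPhi) => //; apply: lee_pemull => //; rewrite lee_fin.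
  have cl0 : (0 < c * l)%R by rewrite mulr_gt0.
  have V0 x : 0 <= `|I f x| / (c * l)%:E.
    by rewrite mule_ge0// inve_ge0 lee_fin ltW.
  apply: (layered_integral_le1 hPhi k1 hk _ g0 mg _ gl) => [x|s s0].
    exact: (young_ext_ge0 hPsi).
  (* With Psi(tau) = Phi(s), the bound by C tau outside [E] becomes a bound of Psi(|I f| / (c l)) by
     Phi(s). *)
  have [tau [tau0 tauE _]] := young_inv_spec hPsi (young_fine_gt0 hPhi s0).
  have [E [mE muE hE]] := hC g s tau s0 tau0 (esym tauE) g0 mg g1.
  exists E; split => // x /hE Ix.
  rewrite -tauE -(youngE hPsi (ltW tau0)).
  apply: (@young_ext_le _ _ hPsi _ tau%:E) => //.
  rewrite ediv_EFin// lee_pdivrMl//; apply: le_trans (abse_I_le x l40 mf) _.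
  apply: (@le_trans _ _ ((4 * k * l)%:E * (C * tau)%:E)).
    by apply: lee_wpmul2l => //; rewrite lee_fin ltW.
  by rewrite -!EFinM lee_fin /c le_eqVlt; apply/orP; left; apply/eqP; ring.
exists c => // f fPhi; have [[mf _] _] := fPhi; split; last first.
  by apply: orlicz_normP => // l l0 fl; exact: strong.
have [l l0 fl] := orlicz_admissible hPhi fPhi.
move=> mIf; split; first by apply: fractional_integral_L1loc => //; exists l.
have cl0 : (0 < c * l)%R by rewrite mulr_gt0.
exists ((c * l)^-1)%R; first by rewrite invr_gt0.
apply: (@le_lt_trans _ _ 1); last exact: ltry.
apply: le_trans (strong f l mf l0 fl); rewrite le_eqVlt; apply/orP; left; apply/eqP.
by apply: eq_integral => x _; rewrite ediv_EFin.
Qed.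

End sufficiency.

(** * Necessity *)

Section necessity.
Context {R : realType} {disp : measure_display} {X : topMeasurableType disp}.
Variables (d : X -> X -> R) (mu : {measure set X -> \bar R}) (Q K1 K3 : R).
Hypothesis d_ge0 : forall x y, (0 <= d x y)%R.
Hypothesis d_sym : forall x y, d x y = d y x.
Hypothesis K1_ge1 : (1 <= K1)%R.
Hypothesis d_triangle : forall x y z, (d x y <= K1 * (d x z + d z y))%R.
Hypothesis mball : forall x r, (0 < r)%R -> measurable (qball d x r).
Hypothesis K3_ge1 : (1 <= K3)%R.
Hypothesis ball_growth : forall x r, (0 < r)%R ->
  (K3^-1 * r `^ Q)%:E <= mu (qball d x r) <= (K3 * r `^ Q)%:E.
Variables (alpha : R) (Phi Psi : R -> \bar R).
Hypotheses (Q_gt0 : (0 < Q)%R) (alphaQ : (alpha < Q)%R).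
Hypotheses (hPhi : young_Y Phi) (hPsi : young_Y Psi).
Variable x0 : X.
Notation I := (fractional_integral d mu Q alpha).

Let K1_gt0 : (0 < K1)%R. Proof. exact: lt_le_trans ltr01 K1_ge1. Qed.
Let K3_gt0 : (0 < K3)%R. Proof. exact: lt_le_trans ltr01 K3_ge1. Qed.

(** The radius making the upper bound K3 rad^Q for the measure of a ball equal to r^Q. *)
Let rad (r : R) := (r * K3 `^ (- Q^-1))%R.
(** Half of the constant in the lower bound for [I f] on the test ball, so that [I f] is strictly
    above [lev r] there. *)
Let kap : R := (2^-1 * (2 * K1) `^ (alpha - Q) * K3^-1 * (K3 `^ (- Q^-1)) `^ alpha)%R.
Let lev (r : R) := (kap * r `^ alpha * fine (young_inv Phi (r `^ (- Q))))%R.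

Let rad_gt0 r : (0 < r)%R -> (0 < rad r)%R.
Proof. by move=> r0; rewrite mulr_gt0// powR_gt0. Qed.

Let radQ r : (0 < r)%R -> ((rad r) `^ Q = r `^ Q / K3)%R.
Proof.
move=> r0; rewrite powRM ?powR_ge0 ?(ltW r0)// -powRrM mulNr mulVf ?gt_eqF//.
by rewrite powR_inv1// ltW.
Qed.

Let kap_gt0 : (0 < kap)%R.
Proof. by rewrite !mulr_gt0 ?powR_gt0 ?invr_gt0// mulr_gt0. Qed.

(** Two points of the ball are at distance less than 2 K1 rho, which bounds the kernel from below;
    the ball has measure at least rho^Q / K3. *)
Lemma fractional_integral_ball_ge (sg rho : R) x : (0 < sg)%R -> (0 < rho)%R ->
  qball d x0 rho x ->
  (sg * (2 * K1) `^ (alpha - Q) * K3^-1 * rho `^ alpha)%:E <=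
  I (fun y => (sg * \1_(qball d x0 rho) y)%:E) x.
Proof.
move=> sg0 rho0 xB; have R0 : (0 < 2 * K1 * rho)%R by rewrite !mulr_gt0.
have mB := mball x0 rho0.
apply: (@le_trans _ _ ((sg * (2 * K1 * rho) `^ (alpha - Q))%:E * mu (qball d x0 rho))).
  apply: (@le_trans _ _ ((sg * (2 * K1 * rho) `^ (alpha - Q))%:E * (K3^-1 * rho `^ Q)%:E)); last first.
    apply: lee_wpmul2l; first by rewrite lee_fin mulr_ge0 ?powR_ge0// ltW.
    by case/andP: (ball_growth x0 rho0).
  rewrite -EFinM lee_fin (@powRM _ (2 * K1)%R rho) ?(ltW rho0) ?mulr_ge0 ?(ltW K1_gt0)//.
  rewrite (_ : rho `^ alpha = rho `^ (alpha - Q) * rho `^ Q)%R.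
    by rewrite le_eqVlt; apply/orP; left; apply/eqP; ring.
  by rewrite -powRD ?subrK// (gt_eqF rho0) implybT.
apply: lower_markov => //.
- by rewrite mulr_ge0 ?powR_ge0// ltW.
- by move=> y; rewrite mule_ge0 ?inve_ge0 ?lee_fin ?powR_ge0// mulr_ge0// ltW.
move=> y yB; rewrite indicE mem_set// mulr1 EFinM; apply: lee_wpmul2l.
  by rewrite lee_fin ltW.
have dxy : (d x y < 2 * K1 * rho)%R.
  have xB' : (d x x0 < rho)%R by rewrite d_sym.
  have := ball_triangle K1_ge1 d_triangle xB' yB; lra.
rewrite -opprB powRN.
have p0 : (0 < (2 * K1 * rho) `^ (Q - alpha))%R by rewrite powR_gt0.
rewrite (_ : _%:E = ((2 * K1 * rho) `^ (Q - alpha))%:E^-1); last by rewrite inver gt_eqF.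
rewrite lee_pV2 ?inE ?lee_fin ?powR_ge0//.
by apply: ge0_ler_powR; rewrite ?nnegrE ?subr_ge0 ?(ltW alphaQ) ?(ltW R0) ?(ltW dxy).
Qed.

(** The function is Phi^-1(r^-Q) on the ball of radius [rad r] and 0 elsewhere: the integral of its
    image under [Phi] is r^-Q times a measure of at most r^Q. *)
Lemma test_function r : (0 < r)%R -> exists f, [/\ orlicz d mu Phi f,
  orlicz_norm mu Phi f <= 1 &
  forall x, qball d x0 (rad r) x -> (2 * lev r)%:E <= I f x].
Proof.
move=> r0; have rho0 := rad_gt0 r0.
have [sg [sg0 sgE sgI]] := young_inv_spec hPhi (powR_gt0 (- Q) r0).
have mB := mball x0 rho0.
pose f : X -> \bar R := fun y => (sg * \1_(qball d x0 (rad r)) y)%:E.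
have f0 y : 0 <= f y by rewrite lee_fin mulr_ge0// ltW.
have mf : measurable_fun setT f.
  apply/measurable_EFinP; apply: measurable_funM => //.
have fle y : f y <= sg%:E.
  by rewrite lee_fin indicE ler_piMr ?(ltW sg0)//; case: (_ \in _).
have f1 : \int[mu]_x young_ext Phi `|f x| <= 1.
  apply: (@le_trans _ _ (\int[mu]_x ((r `^ (- Q))%:E * (\1_(qball d x0 (rad r)) x)%:E))).
    apply: ge0_le_lower_integral => x _; first exact: (young_ext_ge0 hPhi).
    rewrite (gee0_abs (f0 x)) /f/= indicE; case: (_ \in _).
      by rewrite mulr1 mule1 -sgE (youngE hPhi (ltW sg0)).
    by rewrite mulr0 mule0; case: hPhi => -[_ _ _ [-> _] _] _.
  rewrite ge0_integralZl_EFin ?powR_ge0//; last first.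
    by apply/measurable_EFinP; exact: measurable_indic.
  rewrite integral_indic// setIT.
  apply: (@le_trans _ _ ((r `^ (- Q))%:E * (K3 * (rad r) `^ Q)%:E)).
    apply: lee_wpmul2l; first by rewrite lee_fin powR_ge0.
    by case/andP: (ball_growth x0 rho0).
  rewrite radQ// mulrCA divff ?gt_eqF// mulr1 -EFinM powRN mulVf//.
  by rewrite gt_eqF// powR_gt0.
exists f; split.
- split; last first.
    exists 1%R => //; under eq_integral do rewrite mul1e.
    exact: le_lt_trans f1 (ltry _).
  split=> // x u u0; apply/integrableP; split; first exact: measurable_funTS.
  apply: (@le_lt_trans _ _ (\int[mu]_(y in qball d x u) sg%:E)).
    by apply: ge0_le_lower_integral => // y _; rewrite gee0_abs.
  rewrite integral_cst; last exact: mball.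
  rewrite lte_mul_pinfty ?lee_fin ?(ltW sg0)//.
  by case/andP: (ball_growth x u0) => _ /le_lt_trans; apply; exact: ltry.
- apply: ereal_inf_lbound; exists 1%R => //; split => //.
  by under eq_integral do rewrite inve1 mule1.
- move=> x /(fractional_integral_ball_ge sg0 rho0); apply: le_trans.
  rewrite lee_fin /lev sgI/= /rad (@powRM _ r) ?powR_ge0 ?(ltW r0)//.
  by rewrite /kap le_eqVlt; apply/orP; left; apply/eqP; field; rewrite gt_eqF.
Qed.

(** Common end of both necessity proofs. The ball has measure at least r^Q / K3^2, so Psi(lev r / C)
    <= K3^2 r^-Q; convexity moves K3^2 into the argument, and [Psi] is then inverted. *)
Lemma star_of_levels (C : R) : (0 < C)%R ->
  (forall r, (0 < r)%R -> exists2 l, (0 < l < C)%R &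
     Psi (lev r / l)%R * mu (qball d x0 (rad r)) <= 1) ->
  star_condition Q alpha Phi Psi.
Proof.
move=> C0 h; have K32 : (0 < K3 ^+ 2)%R by rewrite exprn_gt0.
exists (K3 ^+ 2 * C / kap)%R; first by rewrite divr_gt0// mulr_gt0.
move=> r r0; have [l /andP[l0 lC] hl] := h r r0.
have [sg [sg0 sgE sgI]] := young_inv_spec hPhi (powR_gt0 (- Q) r0).
have ra0 : (0 < r `^ alpha)%R by rewrite powR_gt0.
have levE : lev r = (kap * r `^ alpha * sg)%R by rewrite /lev sgI.
have lev0 : (0 < lev r)%R by rewrite levE mulr_gt0// mulr_gt0.
have t0 : (0 < lev r / C)%R by rewrite divr_gt0.
have tl0 : (0 < lev r / l)%R by rewrite divr_gt0.
have tl : (lev r / C <= lev r / l)%R by rewrite ler_pM2l// lef_pV2// ltW.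
have psi_le : (fine (Psi (lev r / C)) * (r `^ Q / K3 ^+ 2) <= 1)%R.
  rewrite -lee_fin EFinM; apply: le_trans hl; rewrite (youngE hPsi (ltW tl0)).
  apply: (@le_trans _ _ ((fine (Psi (lev r / l)))%:E * (r `^ Q / K3 ^+ 2)%:E)).
    apply: lee_wpmul2r; first by rewrite lee_fin divr_ge0 ?powR_ge0// ltW.
    by rewrite lee_fin young_fine_le// ltW.
  apply: lee_wpmul2l; first by rewrite lee_fin young_fine_ge0// ltW.
  case/andP: (ball_growth x0 (rad_gt0 r0)) => + _; apply: le_trans.
  rewrite radQ// lee_fin le_eqVlt; apply/orP; left; apply/eqP.
  by field; rewrite gt_eqF.
have h1 : (fine (Psi ((K3 ^+ 2)^-1 * (lev r / C))) <= r `^ (- Q))%R.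
  apply: (le_trans (y := (K3 ^+ 2)^-1 * fine (Psi (lev r / C)))%R).
    apply: young_fine_scale_le => //; last exact: ltW.
    by rewrite invr_ge0 (ltW K32)/= invf_le1// exprn_ege1.
  rewrite powRN -[leRHS]mul1r ler_pdivlMr ?powR_gt0//.
  by apply: le_trans psi_le; rewrite le_eqVlt; apply/orP; left; apply/eqP; ring.
have t'0 : (0 <= (K3 ^+ 2)^-1 * (lev r / C))%R by rewrite mulr_ge0 ?invr_ge0 ?ltW.
have A'0 : 0 <= (K3 ^+ 2 * C / kap)%:E.
  by rewrite lee_fin ltW// divr_gt0// mulr_gt0.
apply: le_trans (lee_wpmul2l A'0 (le_young_inv hPsi t'0 h1)).
rewrite sgI -!EFinM lee_fin levE le_eqVlt; apply/orP; left; apply/eqP.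
by field; rewrite !gt_eqF.
Qed.

(** The infimum defining the norm need not be attained; doubling [C] leaves room for an admissible
    [l]. *)
Let norm_lt (C : R) (S : set R) : (0 < C)%R ->
  ereal_inf [set l%:E | l in [set l | (0 < l)%R /\ S l]] <= C%:E ->
  exists2 l, (0 < l < 2 * C)%R & S l.
Proof.
move=> C0 SC; have : ereal_inf [set l%:E | l in [set l | (0 < l)%R /\ S l]] < (2 * C)%:E.
  by apply: le_lt_trans SC _; rewrite lte_fin; lra.
by move=> /ereal_inf_lt[_ [l [l0 Sl] <-]]; rewrite lte_fin => lC; exists l; rewrite ?l0.
Qed.

Let lev_ge0 r : (0 < r)%R -> (0 < lev r)%R.
Proof.
move=> r0; have [sg [sg0 sgE sgI]] := young_inv_spec hPhi (powR_gt0 (- Q) r0).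
by rewrite /lev sgI/= mulr_gt0// mulr_gt0// powR_gt0.
Qed.

Let norm_le_C (C : R) n m : (0 < C)%R -> n <= C%:E * m -> m <= 1 -> n <= C%:E.
Proof.
move=> C0 nm m1; apply: le_trans nm _; rewrite -[leRHS]mule1.
by apply: lee_wpmul2l => //; rewrite lee_fin ltW.
Qed.

Lemma weak_bounded_star :
  bounded_operator (orlicz d mu Phi) (weak_orlicz d mu Psi)
       (orlicz_norm mu Phi) (weak_orlicz_norm mu Psi) I ->
  star_condition Q alpha Phi Psi.
Proof.
move=> [C C0 hC]; apply: (@star_of_levels (2 * C)%R); first by rewrite mulr_gt0.
move=> r r0; have [f [fPhi f1 fI]] := test_function r0; have lv0 := lev_ge0 r0.
have [_ Cf] := hC f fPhi.
have [l lC hl] := norm_lt C0 (norm_le_C C0 Cf f1).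
exists l => //; have /andP[l0 _] := lC.
apply: (@le_trans _ _ (Psi (lev r / l)%R * distribution_fun mu (I f) (lev r))); last first.
  by apply: le_trans hl; apply: ereal_sup_ubound; exists (lev r).
apply: lee_wpmul2l.
  by rewrite (youngE hPsi) ?lee_fin ?young_fine_ge0// divr_ge0// ltW.
(* The test ball is contained in the superlevel set, whose outer measure is therefore at least the
   measure of the ball. *)
rewrite -(measurable_mu_extE mu (mball x0 (rad_gt0 r0))); apply: le_mu_ext.
move=> x /fI h /=; apply: lt_le_trans (lee_abs _); apply: lt_le_trans h.
by rewrite lte_fin; lra.
Qed.

Lemma strong_bounded_star :
  bounded_operator (orlicz d mu Phi) (orlicz d mu Psi)
       (orlicz_norm mu Phi) (orlicz_norm mu Psi) I ->
  star_condition Q alpha Phi Psi.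
Proof.
move=> [C C0 hC]; apply: (@star_of_levels (2 * C)%R); first by rewrite mulr_gt0.
move=> r r0; have [f [fPhi f1 fI]] := test_function r0; have lv0 := lev_ge0 r0.
have [_ Cf] := hC f fPhi.
have [l lC hl] := norm_lt C0 (norm_le_C C0 Cf f1).
exists l => //; have /andP[l0 _] := lC.
have ll0 : (0 <= lev r / l)%R by rewrite divr_ge0// ltW.
have V0 x : 0 <= `|I f x| / l%:E by rewrite mule_ge0// inve_ge0 lee_fin ltW.
apply: le_trans hl; rewrite (youngE hPsi ll0); apply: lower_markov.
- exact/mball/rad_gt0.
- exact: young_fine_ge0.
- by move=> x; exact: (young_ext_ge0 hPsi).
move=> x /fI h; rewrite -(youngE hPsi ll0).
apply: (@young_ext_le _ _ hPsi (lev r / l)%:E) => //.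
rewrite ediv_EFin// mulrC EFinM; apply: lee_wpmul2l; first by rewrite lee_fin invr_ge0 ltW.
apply: le_trans (lee_abs _); apply: le_trans h.
by rewrite lee_fin; lra.
Qed.

End necessity.

Theorem theorem5p4 (R : realType) (disp : measure_display)
    (X : topMeasurableType disp) (d : X -> X -> R)
    (mu : {measure set X -> \bar R}) (Q alpha : R) (Phi Psi : R -> \bar R)
    (hX : homogeneous_type d mu) (hinf : mu setT = +oo)
    (hdense : Cc_dense_L1 mu)
    (hQ0 : (0 < Q)%R) (hQ : Q_homogeneous d mu Q)
    (halpha : (0 < alpha < Q)%R)
    (hPhi : young_Y Phi) (hPsi : young_Y Psi)
    (hint : exists2 A : R, (0 < A)%R & forall r : R, (0 < r)%R ->
       \int[lebesgue_measure]_(t in `[r, +oo[)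
          ((t `^ (alpha - 1))%:E * young_inv Phi (t `^ (- Q)))
       <= A%:E * ((r `^ alpha)%:E * young_inv Phi (r `^ (- Q)))) :
  (star_condition Q alpha Phi Psi <->
     bounded_operator (orlicz d mu Phi) (weak_orlicz d mu Psi)
       (orlicz_norm mu Phi) (weak_orlicz_norm mu Psi)
       (fractional_integral d mu Q alpha)) /\
  (nabla2 Phi ->
     (star_condition Q alpha Phi Psi <->
        bounded_operator (orlicz d mu Phi) (orlicz d mu Psi)
          (orlicz_norm mu Phi) (orlicz_norm mu Psi)
          (fractional_integral d mu Q alpha))).
Proof.
have [[d0 _ ds [K1 K11 dt]] _ mB _] := hX.
have [K3 K31 bg] := hQ; have [A A0 hA] := hint; have /andP[a0 aQ] := halpha.
(* Infinite total measure provides a point at which to centre the test balls. *)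
have [x0 _] : exists x0 : X, True.
  apply: contrapT => nX; have T0 : [set: X] = set0.
    by apply/seteqP; split => // x _; apply: nX; exists x.
  by move: hinf; rewrite T0 measure0.
split; last move=> Phi2; split.
- exact: (star_weak_bounded d0 ds K11 dt mB K31 bg hQ0 a0 aQ hPhi hPsi A0 hA).
- exact: (weak_bounded_star d0 ds K11 dt mB K31 bg hQ0 aQ hPhi hPsi x0).
- move=> star.
  exact: (star_strong_bounded d0 ds K11 dt mB K31 bg hQ0 a0 aQ hPhi hPsi A0 hA star Phi2).
- exact: (strong_bounded_star d0 ds K11 dt mB K31 bg hQ0 aQ hPhi hPsi x0).
Qed.
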